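(* Let $g:[0,+\infty)\to [0,+\infty)$ be a function such that $\lim_{t\to+\infty}g(t)=+\infty$ and $\lim_{t\to+\infty}\frac{g(t)}{t}=0$. Then there exists a parabolic semigroup $(\phi_t)$ in $\mathbb{D}$ of zero hyperbolic step, with total speed $v(t)$, such that $$\limsup_{t\to+\infty}\frac{v(t)}{g(t)}=+\infty.$$
   Context: Let $\mathbb{D}=\{\zeta\in\mathbb{C}:|\zeta|<1\}$ with hyperbolic distance $\omega(z,w)=\frac12\log\frac{1+|T_z(w)|}{1-|T_z(w)|}$, $T_z(w)=\frac{z-w}{1-\overline{z}w}$. A non-elliptic semigroup in $\mathbb{D}$ is a family $(\phi_t)_{t\ge0}$ of holomorphic maps $\phi_t:\mathbb{D}\to\mathbb{D}$ such that $\phi_0=\mathrm{id}$, $\phi_{t+s}=\phi_t\circ\phi_s$ for all $s,t\ge0$, $t\mapsto\phi_t$ is continuous for the topology of uniform convergence on compacta of $\mathbb{D}$, and $\phi_t$ has no fixed point in $\mathbb{D}$ for $t>0$. Every such semigroup has a Denjoy-Wolff point $\tau\in\partial\mathbb{D}$ (with $\phi_t(z)\to\tau$ as $t\to\infty$ for all $z\in\mathbb{D}$) and an (essentially unique) holomorphic model $(\Omega,h,z+it)$: $h:\mathbb{D}\to\mathbb{C}$ is univalent, $h(\mathbb{D})+it\subseteq h(\mathbb{D})$ and $h(\phi_t(z))=h(z)+it$ for all $z\in\mathbb{D}$, $t\ge0$, and $\Omega=\bigcup_{t\ge0}(h(\mathbb{D})-it)$ is a vertical strip $\{0<\mathrm{Re}\,z<r\}$,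 the right or left half plane, or $\mathbb{C}$. The semigroup is hyperbolic if $\Omega$ is a strip, and parabolic otherwise (equivalently, the angular derivative $\phi_t'(\tau)$ equals $1$ for all $t$). A parabolic semigroup is of zero hyperbolic step if $\Omega=\mathbb{C}$ (equivalently, $\lim_{t\to\infty}\omega(\phi_t(z),\phi_{t+1}(z))=0$ for $z\in\mathbb{D}$). The total speed is $v(t):=\omega(0,\phi_t(0))$, $t\ge0$. *)

(* Defs.v *)
From HB Require Import structures.
From mathcomp Require Import all_boot all_order all_algebra.
From mathcomp Require Import all_classical all_reals all_analysis.
From mathcomp Require Import complex.

Set Implicit Arguments.
Unset Strict Implicit.
Unset Printing Implicit Defensive.

Import Order.TTheory GRing.Theory Num.Theory.
Import numFieldNormedType.Exports.

Local Open Scope classical_set_scope.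
Local Open Scope complex_scope.
Local Open Scope ring_scope.

(* numFieldNormedType provides the norm topology only on bundled number fields;
   R[i] gets here the same structure, as a normed module over itself. Hence
   [derivable f z 1] for f : R[i] -> R[i] is complex differentiability at z. *)
HB.instance Definition _ (R : rcfType) := GRing.ComAlgebra.copy R[i] R[i]^o.
HB.instance Definition _ (R : rcfType) := Vector.copy R[i] R[i]^o.
HB.instance Definition _ (R : rcfType) := NormedModule.copy R[i] R[i]^o.

Definition unit_disk (R : realType) : set R[i] := [set z | `|z| < 1].
Arguments unit_disk : clear implicits.

Definition moebius (R : realType) (z w : R[i]) : R[i] :=
  (z - w) / (1 - z^* * w).

Definition hyp_dist (R : realType) (z w : R[i]) : R :=
  2^-1 * ln ((1 + Normc.normc (moebius z w)) / (1 - Normc.normc (moebius z w))).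

(* Meant for open sets U. *)
Definition holomorphic_on (R : realType) (U : set R[i]) (f : R[i] -> R[i]) :=
  forall z, U z -> derivable f z 1.

Definition univalent_on (R : realType) (U : set R[i]) (f : R[i] -> R[i]) :=
  holomorphic_on U f /\ set_inj U f.

(* Only the values [phi t z] with 0 <= t and z in the unit disk matter. *)
Record nonelliptic_semigroup (R : realType) (phi : R -> R[i] -> R[i]) : Prop :=
  NonellipticSemigroup {
    nes_holo : forall t, 0 <= t -> holomorphic_on (unit_disk R) (phi t);
    nes_disk : forall t z, 0 <= t -> unit_disk R z -> unit_disk R (phi t z);
    nes_id : forall z, unit_disk R z -> phi 0 z = z;
    nes_add : forall s t z, 0 <= s -> 0 <= t -> unit_disk R z ->
      phi (t + s) z = phi t (phi s z);
    (* uniform convergence on compacta of the disk *)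
    nes_cont : {within `[0, +oo[, continuous
      (phi : R -> {family compactly_in (unit_disk R), R[i] -> R[i]})};
    nes_nofix : forall t z, 0 < t -> unit_disk R z -> phi t z <> z }.

Definition vertical_strip (R : realType) (Omega : set R[i]) :=
  exists2 r : R, 0 < r & Omega = [set z | 0 < complex.Re z < r].

Definition model_domain (R : realType) (Omega : set R[i]) :=
  [\/ vertical_strip Omega,
      Omega = [set z | 0 < complex.Re z],
      Omega = [set z | complex.Re z < 0]
    | Omega = setT].

(* (Omega, h, z + it) is a holomorphic model of phi; [0 +i* t] is it. *)
Record holomorphic_model (R : realType) (phi : R -> R[i] -> R[i])
    (Omega : set R[i]) (h : R[i] -> R[i]) : Prop := HolomorphicModel {
  hm_univalent : univalent_on (unit_disk R) h;
  hm_starlike : forall t, 0 <= t ->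
    [set w + (0 +i* t) | w in h @` unit_disk R] `<=` h @` unit_disk R;
  hm_conj : forall t z, 0 <= t -> unit_disk R z ->
    h (phi t z) = h z + (0 +i* t);
  hm_union : Omega = \bigcup_(t in [set t : R | 0 <= t])
    [set w - (0 +i* t) | w in h @` unit_disk R];
  hm_domain : model_domain Omega }.

(* A holomorphic model always exists and is essentially unique, so that the
   type of the semigroup may be read off from any of its models. *)
Definition parabolic (R : realType) (phi : R -> R[i] -> R[i]) :=
  nonelliptic_semigroup phi /\
  exists Omega h, holomorphic_model phi Omega h /\ ~ vertical_strip Omega.

Definition zero_hyperbolic_step (R : realType) (phi : R -> R[i] -> R[i]) :=
  exists h, holomorphic_model phi setT h.

Definition total_speed (R : realType) (phi : R -> R[i] -> R[i]) (t : R) : R :=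
  hyp_dist 0 (phi t 0).

(* Main.v *)
Require Import Defs.
From HB Require Import structures.
From mathcomp Require Import all_boot all_order all_algebra.
From mathcomp Require Import all_classical all_reals all_analysis.
From mathcomp Require Import complex ring lra.
Import Order.TTheory GRing.Theory Num.Theory.
Import numFieldNormedType.Exports.
Import Normc.
Local Open Scope classical_set_scope.
Local Open Scope ring_scope.
Set Implicit Arguments.
Unset Strict Implicit.
Unset Printing Implicit Defensive.

(** The semigroup is built from an explicit Koenigs function of the right
half-plane,
  [h z = \sum_k Log (1 + c_k z)],
where [c_0 = 1] and the [c_k] are positive with a convergent sum; the unit disk is
reached through the Cayley transform, and horizontal translations become vertical
ones after multiplication by [i].

The derivative [h' z = \sum_k c_k / (1 + c_k z)] has positive real part, so that
[h] is univalent on the (convex) half-plane, with a quantitative lower bound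
([koenigs_mono], [koenigs_inv_lipschitz]). The imaginary part of [h] increases
from minus to plus infinity on every vertical line, because each of the infinitely
many terms contributes an angle that tends to [- pi / 2] and [pi / 2]. Each level set
[Im h = s] is thus the graph of a function of [Re z], continuous by the lower
bound, along which [Re h] tends to infinity. Hence the image of [h] contains the
horizontal half-line to the right of each of its points ([koenigs_shift]) and meets
every horizontal line ([koenigs_exhausts]): the maps [h^-1 o (h + t)] form a
semigroup ([disk_flow_semigroup]) whose model has the whole plane as its domain
([disk_flow_model]). Holomorphy and continuity in [t] follow from the lower bound,
uniform on bounded sets, and from the Taylor estimate [koenigs_taylor], uniform on
the half-plane.

The function [h] is real on the real axis, and so is the orbit of [1]; the total
speed at the time [t = h X - h 1] is [(ln X) / 2] ([total_speed_disk_flow]).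
If [c_k] decreases fast enough, only the first [n + 1] terms of [h] matter at a
suitable point [X_n], which gives [h X_n <= (n + 1) (ln X_n + 1) + 2]
([koenigs_sparse_le]). For positive [n], the speed at the corresponding time [t_n] is
therefore at least [t_n / (4 (n + 1))], whereas the points [X_n] are chosen, according to [g], so
large that [g t_n] is at most [t_n / (n + 1) ^ 2]. *)

(** * Modulus, real and imaginary parts *)

Section Modulus.
Context {R : rcfType}.
Implicit Types z w : R[i].

Lemma normc_ge0 z : 0 <= normc z.
Proof. by case: z => x y; exact: sqrtr_ge0. Qed.

Lemma normc_sqr z : normc z ^+ 2 = complex.Re z ^+ 2 + complex.Im z ^+ 2.
Proof. by case: z => x y /=; rewrite sqr_sqrtr// addr_ge0 ?sqr_ge0. Qed.

Lemma Re_le_normc z : `|complex.Re z| <= normc z.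
Proof.
rewrite -ler_sqr ?nnegrE ?normc_ge0// normc_sqr real_normK ?num_real//.
by rewrite lerDl sqr_ge0.
Qed.

Lemma Im_le_normc z : `|complex.Im z| <= normc z.
Proof.
rewrite -ler_sqr ?nnegrE ?normc_ge0// normc_sqr real_normK ?num_real//.
by rewrite lerDr sqr_ge0.
Qed.

Lemma normc_le_ReIm z : normc z <= `|complex.Re z| + `|complex.Im z|.
Proof.
rewrite -ler_sqr ?nnegrE ?normc_ge0 ?addr_ge0// normc_sqr sqrrD.
rewrite !real_normK ?num_real// -addrA lerD2l addrC lerDl.
by rewrite mulrn_wge0// mulr_ge0.
Qed.

Lemma normcD z w : normc (z + w) <= normc z + normc w.
Proof. exact: le_normcD. Qed.

Lemma normcB z w : normc (z - w) = normc (w - z).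
Proof. by rewrite -normcN opprB. Qed.

Lemma normc_eq0 z : (normc z == 0) = (z == 0).
Proof.
by apply/eqP/eqP => [/eq0_normc//|->]; exact: normc0.
Qed.

Lemma normc_gt0 z : (0 < normc z) = (z != 0).
Proof. by rewrite lt_def normc_eq0 normc_ge0 andbT. Qed.

Lemma normc_real (x : R) : normc x%:C%C = `|x|.
Proof. by rewrite /= expr0n addr0 sqrtr_sqr. Qed.

Lemma ReD z w : complex.Re (z + w) = complex.Re z + complex.Re w.
Proof. by case: z; case: w. Qed.
Lemma ImD z w : complex.Im (z + w) = complex.Im z + complex.Im w.
Proof. by case: z; case: w. Qed.
Lemma ReN z : complex.Re (- z) = - complex.Re z.
Proof. by case: z. Qed.
Lemma ImN z : complex.Im (- z) = - complex.Im z.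
Proof. by case: z. Qed.
Lemma ReM z w : complex.Re (z * w) =
  complex.Re z * complex.Re w - complex.Im z * complex.Im w.
Proof. by case: z; case: w. Qed.
Lemma ImM z w : complex.Im (z * w) =
  complex.Re z * complex.Im w + complex.Im z * complex.Re w.
Proof. by case: z; case: w. Qed.
Lemma ReV z : complex.Re z^-1 = complex.Re z / normc z ^+ 2.
Proof. by rewrite normc_sqr; case: z. Qed.
Lemma ImV z : complex.Im z^-1 = - complex.Im z / normc z ^+ 2.
Proof. by rewrite normc_sqr; case: z => x y /=; rewrite mulNr. Qed.

Lemma complexP z w : complex.Re z = complex.Re w ->
  complex.Im z = complex.Im w -> z = w.
Proof. by case: z => a b; case: w => c d /= -> ->. Qed.

End Modulus.

Definition ReImE := (@ReD, @ImD, @ReN, @ImN, @ReM, @ImM).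

(** * The logarithm on the right half-plane *)

(** The principal logarithm, on the right half-plane only: the argument is computed
as the arctangent of the slope. *)
Definition clog {R : realType} (z : R[i]) : R[i] :=
  (ln (normc z) +i* atan (complex.Im z / complex.Re z))%C.

Arguments clog : simpl never.

Section Logarithm.
Context {R : realType}.
Implicit Types z w a b d : R[i].

Lemma Re_clogE z : complex.Re (clog z) = 2^-1 * ln (normc z ^+ 2).
Proof.
have [z0|/negbTE z0] := eqVneq (normc z) 0.
  by rewrite /= z0 expr0n /= ln0// mulr0.
by rewrite lnXn ?lt_def ?z0 ?normc_ge0//= mulr2n; field.
Qed.

Lemma is_derive_affine (x p t : R) : is_derive t (1:R) (fun s : R => x + s * p) p.
Proof.
have -> : (fun s : R => x + s * p) = cst x + p \*: id.
  by apply/funext => s /=; rewrite fctE /= /GRing.scale /= mulrC.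
by apply: is_derive_eq; rewrite add0r /GRing.scale /= mulr1.
Qed.

Lemma is_derive_Re_clog a d (t : R) : 0 < complex.Re (a + t%:C%C * d) ->
  is_derive t (1:R) (fun s : R => complex.Re (clog (a + s%:C%C * d)))
    (complex.Re (d / (a + t%:C%C * d))).
Proof.
case: a d => x y [p q] g; have g0 : 0 < x + t * p.
  by move: g; rewrite !ReImE /= mul0r subr0.
under eq_fun do rewrite Re_clogE normc_sqr !ReImE /= !mul0r subr0 addr0.
rewrite ReM ReV ImV normc_sqr !ReImE /= !mul0r subr0 addr0.
have A0 : 0 < (x + t * p) ^+ 2 + (y + t * q) ^+ 2.
  by rewrite ltr_pwDl ?exprn_gt0// sqr_ge0.
have dx := is_derive_affine x p t; have dy := is_derive_affine y q t.
have dA : is_derive t (1:R) (fun s : R => (x + s * p) ^+ 2 + (y + s * q) ^+ 2)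
    (2 * ((x + t * p) * p + (y + t * q) * q)).
  apply: (@is_derive_eq _ _ _
    ((fun s : R => x + s * p) ^+ 2 + (fun s : R => y + s * q) ^+ 2)).
  by rewrite /GRing.scale /=; ring.
have dl := @is_derive1_comp R (@ln R)
  (fun s : R => (x + s * p) ^+ 2 + (y + s * q) ^+ 2) t _ _ (is_derive1_ln A0) dA.
apply: (@is_derive_eq _ _ _ (2^-1 \*: (@ln R \o
  (fun s : R => (x + s * p) ^+ 2 + (y + s * q) ^+ 2)))).
rewrite /GRing.scale /=; field.
by rewrite gt_eqF.
Qed.

Lemma is_derive_Im_clog a d (t : R) : 0 < complex.Re (a + t%:C%C * d) ->
  is_derive t (1:R) (fun s : R => complex.Im (clog (a + s%:C%C * d)))
    (complex.Im (d / (a + t%:C%C * d))).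
Proof.
case: a d => x y [p q] g; have g0 : 0 < x + t * p.
  by move: g; rewrite !ReImE /= mul0r subr0.
under eq_fun do rewrite /clog /= !mul0r subr0 addr0.
rewrite ImM ReV ImV normc_sqr !ReImE /= !mul0r subr0 addr0.
have A0 : 0 < (x + t * p) ^+ 2 + (y + t * q) ^+ 2.
  by rewrite ltr_pwDl ?exprn_gt0// sqr_ge0.
have dx := is_derive_affine x p t; have dy := is_derive_affine y q t.
have dV := @is_deriveV R (fun s : R => x + s * p) t _ _ (lt0r_neq0 g0) dx.
have dq : is_derive t (1:R) (fun s : R => (y + s * q) / (x + s * p))
    ((q * (x + t * p) - p * (y + t * q)) / (x + t * p) ^+ 2).
  apply: (@is_derive_eq _ _ _
    ((fun s : R => y + s * q) * (fun s : R => (x + s * p)^-1))).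
  rewrite /GRing.scale /=; field.
  by rewrite gt_eqF.
have dl := @is_derive1_comp R (@atan R)
  (fun s : R => (y + s * q) / (x + s * p)) t _ _ (is_derive1_atan _) dq.
apply: (is_derive_eq dl).
field.
by rewrite !gt_eqF.
Qed.

(** Mean value theorem along a segment of the right half-plane, for a real
linear combination of the real and imaginary parts of the logarithm. *)
Lemma clog_MVT a b (l m : R) : 0 < complex.Re a -> 0 < complex.Re b ->
  exists2 t : R, 0 <= t <= 1 & 
    l * complex.Re (clog b - clog a) + m * complex.Im (clog b - clog a) =
    l * complex.Re ((b - a) / (a + t%:C%C * (b - a))) +
    m * complex.Im ((b - a) / (a + t%:C%C * (b - a))).
Proof.
move=> a0 b0; set d := b - a.
have g0 (t : R) : 0 <= t <= 1 -> 0 < complex.Re (a + t%:C%C * d).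
  move=> /andP[t0 t1]; rewrite /d; case: a b a0 b0 {d} => x y [p q] /= a0 b0.
  rewrite !mul0r subr0.
  have [->|tn0] := eqVneq t 0; first by rewrite mul0r addr0.
  have : 0 < t by rewrite lt_def tn0.
  nra.
pose f t := l * complex.Re (clog (a + t%:C%C * d)) +
            m * complex.Im (clog (a + t%:C%C * d)).
have df (t : R) : 0 <= t <= 1 -> is_derive t (1:R) f
    (l * complex.Re (d / (a + t%:C%C * d)) + m * complex.Im (d / (a + t%:C%C * d))).
  move=> /g0 gt; have d1 := is_derive_Re_clog gt; have d2 := is_derive_Im_clog gt.
  exact: (@is_derive_eq _ _ _ (l \*: _ + m \*: _)).
have [||t] := @MVT_segment R f (fun t : R => l * complex.Re (d / (a + t%:C%C * d)) +
  m * complex.Im (d / (a + t%:C%C * d))) 0 1 ler01.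
- by move=> t; rewrite in_itv /= => /andP[t0 t1]; apply: df; rewrite !ltW.
- apply: derivable_within_continuous => t; rewrite in_itv /= => t01.
  by have := df t t01; case.
rewrite in_itv /= => t01; rewrite subr0 mulr1 => ft.
exists t => //; rewrite -ft /f (_ : a + 1%:C%C * d = b); last first.
  by rewrite mul1r /d addrC subrK.
rewrite (_ : a + 0%:C%C * d = a); last by rewrite mul0r addr0.
by rewrite /=; ring.
Qed.

(** The derivative of the logarithm has positive real part; at the intermediate
point [g] of the segment, [Re g / normc g ^+ 2] is the real part of [g^-1]. *)
Lemma clog_mono a b : 0 < complex.Re a -> 0 < complex.Re b ->
  exists2 t : R, 0 <= t <= 1 &
  let g := a + t%:C%C * (b - a) in
  complex.Re ((clog b - clog a) * conjc (b - a)) =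
  normc (b - a) ^+ 2 * complex.Re g / normc g ^+ 2.
Proof.
move=> a0 b0; have [t t01 e] := clog_MVT (complex.Re (b - a)) (complex.Im (b - a)) a0 b0.
exists t => // g; move: e; rewrite -/g.
set D := b - a; set L := clog b - clog a.
rewrite (_ : complex.Re (L * conjc D) =
  complex.Re D * complex.Re L + complex.Im D * complex.Im L); last first.
  by rewrite ReM; case: (D) => ? ? /=; ring.
by move=> ->; rewrite !ReM !ImM ReV ImV (normc_sqr D); ring.
Qed.

Lemma Re_segment a b (t : R) : 0 <= t <= 1 -> 1 <= complex.Re a -> 1 <= complex.Re b ->
  1 <= complex.Re (a + t%:C%C * (b - a)).
Proof.
case: a b => x y [p q] /= /andP[t0 t1] a1 b1.
rewrite mul0r subr0; nra.
Qed.

Lemma normc_ge_Re z (c : R) : c <= complex.Re z -> c <= normc z.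
Proof. by move=> /le_trans; apply; apply: le_trans (ler_norm _) (Re_le_normc _). Qed.

Lemma clog_lipschitz a b : 1 <= complex.Re a -> 1 <= complex.Re b ->
  normc (clog b - clog a) <= 2 * normc (b - a).
Proof.
move=> a1 b1; have a0 := lt_le_trans ltr01 a1; have b0 := lt_le_trans ltr01 b1.
have dB (t : R) : 0 <= t <= 1 -> normc ((b - a) / (a + t%:C%C * (b - a))) <= normc (b - a).
  move=> t01; have g1 := normc_ge_Re (Re_segment t01 a1 b1).
  by rewrite normcM normcV ler_pdivrMr ?(lt_le_trans ltr01)// ler_peMr ?normc_ge0.
apply: le_trans (normc_le_ReIm _) _; rewrite mulr_natl mulr2n lerD//.
- have [t t01] := clog_MVT 1 0 a0 b0.
  rewrite !mul1r !mul0r !addr0 => ->.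
  exact: le_trans (Re_le_normc _) (dB _ t01).
- have [t t01] := clog_MVT 0 1 a0 b0.
  rewrite !mul1r !mul0r !add0r => ->.
  exact: le_trans (Im_le_normc _) (dB _ t01).
Qed.

(** First-order Taylor formula for the logarithm; the remainder is controlled
without [1 / normc a ^+ 2] because moduli are at least [1] here. *)
Lemma clog_taylor a b : 1 <= complex.Re a -> 1 <= complex.Re b ->
  normc (clog b - clog a - (b - a) / a) <= 2 * normc (b - a) ^+ 2.
Proof.
move=> a1 b1; have a0 := lt_le_trans ltr01 a1; have b0 := lt_le_trans ltr01 b1.
have na := normc_ge_Re a1.
have anz : a != 0 by rewrite -normc_gt0 (lt_le_trans ltr01).
have dB (t : R) : 0 <= t <= 1 ->
    normc ((b - a) / (a + t%:C%C * (b - a)) - (b - a) / a) <= normc (b - a) ^+ 2.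
  move=> t01; have g1 := normc_ge_Re (Re_segment t01 a1 b1).
  set g := a + _ in g1 *.
  have gnz : g != 0 by rewrite -normc_gt0 (lt_le_trans ltr01).
  have -> : (b - a) / g - (b - a) / a = - t%:C%C * (b - a) ^+ 2 / (g * a).
    apply: (mulIf (mulf_neq0 gnz anz)); rewrite mulfVK ?mulf_neq0// mulrBl.
    rewrite [_ / g * _]mulrA mulfVK// [g * a]mulrC [_ / a * _]mulrA mulfVK//.
    by rewrite /g; ring.
  rewrite !normcM normcN normc_real normcV normcM expr2.
  have /andP[t0 t1] := t01; rewrite ger0_norm// ler_pdivrMr; last first.
    by rewrite mulr_gt0// (lt_le_trans ltr01).
  have n0 := mulr_ge0 (normc_ge0 (b - a)) (normc_ge0 (b - a)).
  apply: (@le_trans _ _ (normc (b - a) * normc (b - a))); first by rewrite ler_piMl.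
  by rewrite ler_peMr// -[1]mulr1 ler_pM.
apply: le_trans (normc_le_ReIm _) _; rewrite mulr_natl mulr2n lerD//.
- have [t t01] := clog_MVT 1 0 a0 b0.
  rewrite !mul1r !mul0r !addr0 => e; rewrite ReD e -ReD.
  exact: le_trans (Re_le_normc _) (dB _ t01).
- have [t t01] := clog_MVT 0 1 a0 b0.
  rewrite !mul1r !mul0r !add0r => e; rewrite ImD e -ImD.
  exact: le_trans (Im_le_normc _) (dB _ t01).
Qed.

Lemma clog1 : clog (1 : R[i]) = 0.
Proof. by rewrite /clog normc1 ln1 /= mul0r atan0. Qed.

End Logarithm.
(** * Series of complex numbers dominated by a convergent real series *)

Section DominatedSeries.
Context {R : realType} (c : nat -> R).
Hypothesis c_cvg : cvgn (series c).
Let S := limn (series c).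

Lemma dominated_cvg (u : nat -> R) (M : R) :
  (forall k, `|u k| <= M * c k) -> cvgn (series u).
Proof.
move=> uM; apply: normed_cvg.
apply: (@series_le_cvg R (fun k => `|u k|) (M *: c)) => //.
- by move=> k; apply: le_trans (uM k).
- exact: is_cvg_seriesZ.
Qed.

Lemma dominated_lim (u : nat -> R) (M : R) :
  (forall k, `|u k| <= M * c k) -> `|limn (series u)| <= M * S.
Proof.
move=> uM; have cu := dominated_cvg uM.
have cM : cvgn (series (M *: c)) by exact: is_cvg_seriesZ.
have e : limn (series (M *: c)) = M * S by rewrite lim_seriesZ.
have uM' k : - (M * c k) <= u k <= M * c k by rewrite -ler_norml.
rewrite ler_norml; apply/andP; split.
  have cN : cvgn (series (- u)) by rewrite is_cvg_seriesN.
  rewrite lerNl -e -lim_seriesN//; apply: lim_series_le => // k.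
  by rewrite /= lerNl; have /andP[] := uM' k.
by rewrite -e; apply: lim_series_le => // k; have /andP[] := uM' k.
Qed.

Lemma series_le_lim (u : nat -> R) n : (forall k, 0 <= u k) ->
  cvgn (series u) -> \sum_(k < n) u k <= limn (series u).
Proof.
move=> u0 cu; have := @nondecreasing_cvgn_le R (series u) _ cu n.
rewrite /series /= big_mkord; apply.
by apply/nondecreasing_series => k _ _.
Qed.

Implicit Types f g : nat -> R[i].

(** Sum of a series of complex numbers, computed componentwise. *)
Definition csum f : R[i] :=
  (limn (series (fun k => complex.Re (f k))) +i*
   limn (series (fun k => complex.Im (f k))))%C.

(** Domination, up to a constant, by the convergent series of the [c k]. *)
Definition dominated f := exists M : R, forall k, normc (f k) <= M * c k.

Lemma dominated_Re f : dominated f -> cvgn (series (fun k => complex.Re (f k))).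
Proof.
by move=> [M fM]; apply: (@dominated_cvg _ M) => k; apply: le_trans (Re_le_normc _) _.
Qed.

Lemma dominated_Im f : dominated f -> cvgn (series (fun k => complex.Im (f k))).
Proof.
by move=> [M fM]; apply: (@dominated_cvg _ M) => k; apply: le_trans (Im_le_normc _) _.
Qed.

Lemma dominatedB f g : dominated f -> dominated g ->
  dominated (fun k => f k - g k).
Proof.
move=> [M fM] [N gN]; exists (M + N) => k; rewrite mulrDl.
by apply: le_trans (normcD _ _) _; rewrite normcN lerD.
Qed.

Lemma dominatedM f a : dominated f -> dominated (fun k => f k * a).
Proof.
move=> [M fM]; exists (normc a * M) => k; rewrite normcM mulrC -mulrA.
by rewrite ler_wpM2l// normc_ge0.
Qed.

Lemma csumB f g : dominated f -> dominated g ->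
  csum (fun k => f k - g k) = csum f - csum g.
Proof.
move=> df dg; apply: complexP; rewrite !(ReD, ReN, ImD, ImN) /=.
- rewrite -lim_seriesB; [|exact: dominated_Re|exact: dominated_Re].
  by congr (limn (series _)); apply/funext => k; rewrite ReD ReN.
- rewrite -lim_seriesB; [|exact: dominated_Im|exact: dominated_Im].
  by congr (limn (series _)); apply/funext => k; rewrite ImD ImN.
Qed.

Lemma csumM f a : dominated f -> csum (fun k => f k * a) = csum f * a.
Proof.
move=> df; have dR := dominated_Re df; have dI := dominated_Im df.
have E (l m : R) : limn (series (fun k => l * complex.Re (f k) + m * complex.Im (f k)))
   = l * limn (series (fun k => complex.Re (f k))) +
     m * limn (series (fun k => complex.Im (f k))).
  rewrite -[l * _]/(l *: _) -[m * _]/(m *: _) -!lim_seriesZ// -lim_seriesD//;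
    exact: is_cvg_seriesZ.
apply: complexP; rewrite (ReM, ImM) /=.
- rewrite mulrC -[X in _ - X]mulrC -mulNr -E.
  by congr (limn (series _)); apply/funext => k; rewrite ReM; ring.
- rewrite mulrC -[X in _ + X]mulrC -E.
  by congr (limn (series _)); apply/funext => k; rewrite ImM; ring.
Qed.

Lemma normc_csum f (M : R) : (forall k, normc (f k) <= M * c k) ->
  normc (csum f) <= 2 * M * S.
Proof.
move=> fM; apply: le_trans (normc_le_ReIm _) _ => /=.
rewrite -mulrA mulr_natl mulr2n lerD//; apply: dominated_lim => k.
- exact: le_trans (Re_le_normc _) (fM k).
- exact: le_trans (Im_le_normc _) (fM k).
Qed.

Lemma Re_csum_ge f : dominated f -> (forall k, 0 <= complex.Re (f k)) ->
  complex.Re (f 0) <= complex.Re (csum f).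
Proof.
move=> df f0; have := @series_le_lim _ 1 f0 (dominated_Re df).
by rewrite big_ord1.
Qed.

Lemma Im_csum_ge f n : dominated f -> (forall k, 0 <= complex.Im (f k)) ->
  \sum_(k < n) complex.Im (f k) <= complex.Im (csum f).
Proof. by move=> df f0; exact: (series_le_lim _ f0 (dominated_Im df)). Qed.

End DominatedSeries.

(** * The Koenigs function of the right half-plane *)

Section Koenigs.
Context {R : realType} (c : nat -> R).
Hypothesis c_gt0 : forall k, 0 < c k.
Hypothesis c_le1 : forall k, c k <= 1.
Hypothesis c_0 : c 0%N = 1.
Hypothesis c_cvg : cvgn (series c).
Let S := limn (series c).
Implicit Types z w : R[i].

(** The Koenigs function of the semigroup, in the right half-plane. It is also used
on the imaginary axis, where it is still defined. *)
Definition koenigs z : R[i] := csum (fun k => clog (1 + (c k)%:C%C * z)).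

(** The derivative of the Koenigs function. *)
Definition dkoenigs z : R[i] := csum (fun k => (c k)%:C%C / (1 + (c k)%:C%C * z)).

Let c_ge0 k : 0 <= c k. Proof. exact: ltW. Qed.

Lemma sum_c_ge1 : 1 <= S.
Proof. by have := series_le_lim 1 c_ge0 c_cvg; rewrite big_ord1 c_0. Qed.

Lemma Re_arg k z : 0 <= complex.Re z -> 1 <= complex.Re (1 + (c k)%:C%C * z).
Proof. by case: z => x y /= x0; rewrite mul0r subr0 lerDl mulr_ge0. Qed.

Let argB k z w : 1 + (c k)%:C%C * w - (1 + (c k)%:C%C * z) = (c k)%:C%C * (w - z).
Proof. by ring. Qed.

Let normc_c k z : normc ((c k)%:C%C * z) = normc z * c k.
Proof. by rewrite normcM normc_real ger0_norm// mulrC. Qed.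

Let diff_le k z w : 0 <= complex.Re z -> 0 <= complex.Re w ->
  normc (clog (1 + (c k)%:C%C * w) - clog (1 + (c k)%:C%C * z)) <=
  2 * normc (w - z) * c k.
Proof.
move=> z0 w0; have := clog_lipschitz (Re_arg k z0) (Re_arg k w0).
by rewrite argB normc_c mulrA.
Qed.

Lemma dominated_koenigs z : 0 <= complex.Re z ->
  dominated c (fun k => clog (1 + (c k)%:C%C * z)).
Proof.
move=> z0; exists (2 * normc z) => k.
have := @diff_le k 0 z (lexx _) z0; by rewrite mulr0 addr0 clog1 !subr0.
Qed.

Lemma dominated_dkoenigs z : 0 <= complex.Re z ->
  dominated c (fun k => (c k)%:C%C / (1 + (c k)%:C%C * z)).
Proof.
move=> z0; exists 1 => k; have n1 := normc_ge_Re (Re_arg k z0).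
rewrite normcM normcV normc_real ger0_norm// mulrC.
by rewrite ler_wpM2r// invf_le1// (lt_le_trans ltr01).
Qed.

Lemma koenigs_lipschitz z w : 0 <= complex.Re z -> 0 <= complex.Re w ->
  normc (koenigs w - koenigs z) <= 4 * S * normc (w - z).
Proof.
move=> z0 w0; rewrite /koenigs -(csumB c_cvg); [|exact: dominated_koenigs..].
have := normc_csum c_cvg (fun k => diff_le k z0 w0).
by rewrite -/S => /le_trans; apply; lra.
Qed.

(** Taylor formula with a remainder uniform over the half-plane: the remainder of
the [k]-th term is at most [2 * c k ^+ 2 * normc (w - z) ^+ 2]. *)
Lemma koenigs_taylor z w : 0 <= complex.Re z -> 0 <= complex.Re w ->
  normc (koenigs w - koenigs z - dkoenigs z * (w - z)) <= 4 * S * normc (w - z) ^+ 2.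
Proof.
move=> z0 w0.
have dz := dominated_koenigs z0; have dw := dominated_koenigs w0.
have dd := dominated_dkoenigs z0.
rewrite /koenigs -(csumB c_cvg)// -(csumM c_cvg)//.
rewrite -(csumB c_cvg); [|exact: dominatedB|exact: dominatedM].
have := @normc_csum _ c c_cvg (fun k => clog (1 + (c k)%:C%C * w) -
  clog (1 + (c k)%:C%C * z) - (c k)%:C%C / (1 + (c k)%:C%C * z) * (w - z))
  (2 * normc (w - z) ^+ 2).
rewrite -/S => H; apply: le_trans (H _) _; last by lra.
move=> k; have := clog_taylor (Re_arg k z0) (Re_arg k w0).
rewrite argB normc_c [_ * (w - z) / _]mulrAC => /le_trans; apply.
rewrite exprMn mulrA ler_wpM2l//; first by rewrite mulr_ge0// exprn_ge0// normc_ge0.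
by rewrite expr2 ler_piMl.
Qed.

Let term_mono k z w : 0 <= complex.Re z -> 0 <= complex.Re w ->
  0 <= complex.Re ((clog (1 + (c k)%:C%C * w) - clog (1 + (c k)%:C%C * z)) *
                   conjc (w - z)).
Proof.
move=> z0 w0; have [z1 w1] := (Re_arg k z0, Re_arg k w0).
have [t t01 /=] := clog_mono (lt_le_trans ltr01 z1) (lt_le_trans ltr01 w1).
rewrite argB; set g := 1 + _ + _ => e.
rewrite -(pmulr_rge0 _ (c_gt0 k)).
have -> (L D : R[i]) (x : R) : x * complex.Re (L * conjc D) =
    complex.Re (L * conjc (x%:C%C * D)).
  by case: L => p q; case: D => r s /=; rewrite !mul0r; ring.
rewrite e mulr_ge0// ?invr_ge0 ?exprn_ge0 ?normc_ge0// mulr_ge0 ?exprn_ge0 ?normc_ge0//.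
by have := Re_segment t01 z1 w1; rewrite argB -/g; apply: le_trans.
Qed.

(** Quantitative form of the univalence of the Koenigs function. Every term of the
series has a nonnegative contribution; the bound is that of the term [k = 0]. *)
Lemma koenigs_mono (M : R) z w : 0 <= complex.Re z -> 0 <= complex.Re w ->
  normc z <= M -> normc w <= M ->
  normc (w - z) ^+ 2 / (1 + M) ^+ 2 <=
  complex.Re ((koenigs w - koenigs z) * conjc (w - z)).
Proof.
move=> z0 w0 zM wM.
have M0 : 0 <= M by exact: le_trans (normc_ge0 _) zM.
have dz := dominated_koenigs z0; have dw := dominated_koenigs w0.
have dB := dominatedB dw dz.
rewrite /koenigs -(csumB c_cvg)// -(csumM c_cvg)//.
apply: le_trans _ (Re_csum_ge c_cvg _ (fun k => term_mono k z0 w0)); last first.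
  exact: dominatedM.
(* From here on only the term k = 0 is concerned, with argument 1 + z. *)
rewrite c_0 !mul1r.
have := Re_arg 0 z0; have := Re_arg 0 w0; rewrite c_0 !mul1r => w1 z1.
have [t t01 /=] := clog_mono (lt_le_trans ltr01 z1) (lt_le_trans ltr01 w1).
have := Re_segment t01 z1 w1.
rewrite (_ : 1 + w - (1 + z) = w - z); last by ring.
set g := 1 + z + _ => g1 ->.
have gp : 0 < normc g by apply: lt_le_trans ltr01 (normc_ge_Re g1).
have gM : normc g <= 1 + M.
  have -> : g = 1 + ((1 - t)%:C%C * z + t%:C%C * w).
    by rewrite /g rmorphB /= rmorph1; ring.
  apply: le_trans (normcD _ _) _; rewrite normc1 lerD2l.
  apply: le_trans (normcD _ _) _; rewrite !normcM !normc_real.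
  have /andP[t0 t1] := t01; rewrite !ger0_norm ?subr_ge0//.
  nra.
rewrite -[leRHS]mulrA ler_wpM2l ?exprn_ge0 ?normc_ge0//.
have gV : ((1 + M) ^+ 2)^-1 <= (normc g ^+ 2)^-1.
  rewrite lef_pV2 ?posrE ?exprn_gt0// ?ltr_wpDr//.
  by rewrite ler_sqr ?nnegrE ?addr_ge0// ltW.
by rewrite -[leLHS]mul1r ler_pM// invr_ge0 exprn_ge0// addr_ge0.
Qed.

Lemma koenigs_inv_lipschitz (M : R) z w : 0 <= complex.Re z -> 0 <= complex.Re w ->
  normc z <= M -> normc w <= M ->
  normc (w - z) <= (1 + M) ^+ 2 * normc (koenigs w - koenigs z).
Proof.
move=> z0 w0 zM wM; have := koenigs_mono z0 w0 zM wM.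
have M0 : 0 <= M by exact: le_trans (normc_ge0 _) zM.
have M1 : 0 < (1 + M) ^+ 2 by rewrite exprn_gt0// ltr_wpDr.
have [->|wz] := eqVneq w z.
  by rewrite !subrr normc0 => _; rewrite mulr0.
have nwz : 0 < normc (w - z) by rewrite normc_gt0 subr_eq0.
rewrite ler_pdivrMr// => /le_trans - /(_ (normc (koenigs w - koenigs z) *
  normc (w - z) * (1 + M) ^+ 2)) H.
rewrite -(ler_pM2r nwz) -expr2; apply: (le_trans (H _)); last by lra.
rewrite ler_pM2r//; apply: le_trans (ler_norm _) _; apply: le_trans (Re_le_normc _) _.
by rewrite normcM (_ : normc (conjc _) = normc (w - z)) //; case: (w - z) => x y /=;
  rewrite sqrrN.
Qed.

Lemma koenigs_inj z w : 0 <= complex.Re z -> 0 <= complex.Re w ->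
  koenigs z = koenigs w -> z = w.
Proof.
move=> z0 w0 e; apply/eqP; rewrite -subr_eq0 -normc_eq0 eq_le normc_ge0 andbT.
have := @koenigs_inv_lipschitz (Num.max (normc z) (normc w)) w z w0 z0.
by rewrite !le_max !lexx orbT e subrr normc0 mulr0; apply.
Qed.

(** The term [k = 0] bounds the real part from below. *)
Lemma Re_koenigs_ge z : 0 <= complex.Re z ->
  ln (normc (1 + z)) <= complex.Re (koenigs z).
Proof.
move=> z0; have := Re_csum_ge c_cvg (dominated_koenigs z0).
rewrite c_0 mul1r /clog /=; apply => k; apply: ln_ge0.
exact: normc_ge_Re (Re_arg k z0).
Qed.

Lemma koenigs_le z : 0 <= complex.Re z -> normc (koenigs z) <= 4 * S * normc z.
Proof.
move=> z0; have := @koenigs_lipschitz 0 z (lexx _) z0.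
have -> : koenigs 0 = 0; last by rewrite !subr0.
rewrite /koenigs.
have -> : (fun k => clog (1 + (c k)%:C%C * 0)) = (fun=> 0).
  by apply/funext => k; rewrite mulr0 addr0 clog1.
by apply: complexP => /=; rewrite (_ : series _ = fun=> 0) ?lim_cst//;
  apply/funext => n; rewrite /series /= big1.
Qed.

Lemma Re_dkoenigs_gt0 z : 0 <= complex.Re z -> 0 < complex.Re (dkoenigs z).
Proof.
move=> z0.
have p k : 0 < complex.Re ((c k)%:C%C / (1 + (c k)%:C%C * z)).
  have g1 := Re_arg k z0; rewrite ReM ReV /= mul0r subr0 mulr_gt0// divr_gt0//.
    exact: lt_le_trans ltr01 g1.
  by rewrite exprn_gt0// (lt_le_trans ltr01 (normc_ge_Re g1)).
apply: lt_le_trans (Re_csum_ge c_cvg (dominated_dkoenigs z0) _); first exact: p.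
by move=> k; exact: ltW.
Qed.

Lemma Im_koenigs_conj z : 0 <= complex.Re z ->
  complex.Im (koenigs (conjc z)) = - complex.Im (koenigs z).
Proof.
move=> z0 /=; rewrite -lim_seriesN; last exact: (dominated_Im c_cvg (dominated_koenigs z0)).
congr (limn (series _)); apply/funext => k.
rewrite -[RHS]/(- complex.Im (clog (1 + (c k)%:C%C * z))).
case: z z0 => x y /= _.
by rewrite !mul0r !add0r !addr0 -atanN -mulNr mulrN.
Qed.

Lemma Im_koenigs_ge (x y : R) n : 0 <= x -> 0 <= y ->
  \sum_(k < n) atan (c k * y / (1 + c k * x)) <= complex.Im (koenigs (x +i* y)%C).
Proof.
move=> x0 y0; have d := @dominated_koenigs (x +i* y)%C x0.
have e k : complex.Im (clog (1 + (c k)%:C%C * (x +i* y)%C)) =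
   atan (c k * y / (1 + c k * x)).
  by rewrite /= !mul0r add0r addr0 subr0.
have := @Im_csum_ge _ c c_cvg _ n d.
under eq_bigr do rewrite e; apply => k; rewrite e -[leLHS]atan0 le_atan//.
by rewrite divr_ge0// ?mulr_ge0// addr_ge0// mulr_ge0.
Qed.

End Koenigs.
(** * The image of the Koenigs function is invariant under translations *)

Lemma IVT_lipschitz {R : realType} (f : R -> R) (a b K v : R) : a <= b ->
  (forall x y, a <= x <= b -> a <= y <= b -> `|f y - f x| <= K * `|y - x|) ->
  f a <= v <= f b -> exists2 x, a <= x <= b & f x = v.
Proof.
move=> ab fK /andP[av vb].
have cf : {within `[a, b], continuous f}.
  apply/subspace_continuousP => x; rewrite /= in_itv /= => xab.
  apply/cvgrPdist_le => e e0.
  have K1 : 0 < `|K| + 1 by rewrite ltr_wpDl.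
  have : \forall y \near x, `|x - y| < e / (`|K| + 1).
    by apply: (@cvgr_dist_lt _ _ _ (nbhs x) _ id); [exact: cvg_id|exact: divr_gt0].
  move=> near_x; rewrite near_withinE; apply: filterS near_x => y xy yab.
  rewrite /= in_itv /= in yab.
  apply: le_trans (fK _ _ yab xab) _.
  apply: (@le_trans _ _ ((`|K| + 1) * `|x - y|)).
    by rewrite ler_wpM2r// (le_trans (ler_norm K))// lerDl.
  by rewrite mulrC -ler_pdivlMr// ltW.
have [|x] := @IVT R f a b v ab cf.
  by rewrite ge_min le_max av vb orbT.
by rewrite in_itv /= => xab fx; exists x.
Qed.

Section Shift.
Context {R : realType} (c : nat -> R).
Hypothesis c_gt0 : forall k, 0 < c k.
Hypothesis c_le1 : forall k, c k <= 1.
Hypothesis c_0 : c 0%N = 1.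
Hypothesis c_cvg : cvgn (series c).
Let S := limn (series c).
Implicit Types z w : R[i].
Local Notation h := (koenigs c).

Let S_ge1 : 1 <= S. Proof. exact: (sum_c_ge1 c_gt0 c_0). Qed.

(** The imaginary part of the Koenigs function is strictly increasing on vertical
lines. *)
Lemma Im_koenigs_vertical_mono (M x y y' : R) : 0 <= x ->
  normc (x +i* y)%C <= M -> normc (x +i* y')%C <= M ->
  (y' - y) ^+ 2 <= (1 + M) ^+ 2 *
    ((y' - y) * (complex.Im (h (x +i* y')%C) - complex.Im (h (x +i* y)%C))).
Proof.
move=> x0 yM y'M.
have := @koenigs_mono _ c c_gt0 c_0 c_cvg M (x +i* y)%C (x +i* y')%C x0 x0 yM y'M.
have M0 : 0 <= M by exact: le_trans (normc_ge0 _) yM.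
rewrite normc_sqr ReM.
have -> : complex.Re ((x +i* y')%C - (x +i* y)%C) = 0 by rewrite ReD ReN /= subrr.
have -> : complex.Re (conjc ((x +i* y')%C - (x +i* y)%C)) = 0 by rewrite /= subrr.
have -> : complex.Im ((x +i* y')%C - (x +i* y)%C) = y' - y by rewrite ImD ImN.
have -> : complex.Im (conjc ((x +i* y')%C - (x +i* y)%C)) = - (y' - y) by [].
rewrite expr0n add0r mulr0 sub0r mulrN opprK ImD ImN ler_pdivrMr; last first.
  by rewrite exprn_gt0// ltr_wpDr.
by move=> H; apply: le_trans H _; rewrite le_eqVlt; apply/orP; left; apply/eqP; ring.
Qed.

(** The imaginary part of the Koenigs function is unbounded on vertical lines,
because its series has infinitely many terms, each tending to pi / 2. *)
Lemma Im_koenigs_large (X s : R) : 0 <= X -> exists2 Y : R, 0 <= Y &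
  forall x y, 0 <= x <= X -> Y <= y -> s < complex.Im (h (x +i* y)%C).
Proof.
move=> X0; have pi4 : 0 < pi / 4 :> R by rewrite divr_gt0// pi_gt0.
have [n ns] : exists n : nat, s < (pi / 4) *+ n.
  exists (Num.bound (s / (pi / 4))).
  have [s0|s0] := leP 0 s.
    by rewrite -mulr_natl -ltr_pdivrMr// archi_boundP// divr_ge0// ltW.
  by apply: lt_le_trans s0 _; rewrite mulrn_wge0// ltW.
have t0 k : 0 <= (1 + X) / c k by rewrite divr_ge0// ?addr_ge0// ltW.
exists (\sum_(k < n) (1 + X) / c k); first by apply: sumr_ge0.
move=> x y /andP[x0 xX] Yy.
have y0 : 0 <= y by apply: le_trans Yy; apply: sumr_ge0.
apply: lt_le_trans ns _.
apply: le_trans _ (Im_koenigs_ge c_gt0 c_cvg n x0 y0).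
have -> : (pi / 4) *+ n = \sum_(k < n) (pi / 4 : R) by rewrite sumr_const card_ord.
apply: ler_sum => k _; rewrite -atan1 le_atan//.
have d0 : 0 < 1 + c k * x by rewrite ltr_wpDr// mulr_ge0// ltW.
rewrite ler_pdivlMr// mul1r.
have ky : (1 + X) / c k <= y.
  apply: le_trans Yy; rewrite (bigD1 k)//= lerDl; exact: sumr_ge0.
move: ky; rewrite ler_pdivrMr// [y * _]mulrC; apply: le_trans.
by rewrite lerD2l (le_trans _ xX)// ler_piMl.
Qed.

Let h_conj (x y : R) : 0 <= x ->
  complex.Im (h (x +i* - y)%C) = - complex.Im (h (x +i* y)%C).
Proof. by move=> x0; rewrite -(Im_koenigs_conj c_gt0 c_cvg (z := (x +i* y)%C)). Qed.

Let normc_vert (x y y' : R) : normc ((x +i* y')%C - (x +i* y)%C) = `|y' - y|.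
Proof. by rewrite /= subrr expr0n add0r sqrtr_sqr. Qed.

Lemma Im_koenigs_surj (x s : R) : 0 <= x -> exists y, complex.Im (h (x +i* y)%C) = s.
Proof.
move=> x0; have [Y Y0 hY] := Im_koenigs_large `|s| x0.
have hYs : `|s| < complex.Im (h (x +i* Y)%C) by apply: hY; rewrite ?x0/=.
have [|||y _ <-] := @IVT_lipschitz R (fun y => complex.Im (h (x +i* y)%C)) (- Y) Y (4 * S) s.
- by rewrite ge0_cp.
- move=> y y' _ _; rewrite -ImN -ImD; apply: le_trans (Im_le_normc _) _.
  by apply: le_trans (koenigs_lipschitz c_gt0 c_cvg _ _) _ => //; rewrite normc_vert.
- rewrite h_conj// lerNl; apply/andP; split.
    by apply: le_trans (ltW hYs); rewrite -normrN ler_norm.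
  by apply: le_trans (ltW hYs); rewrite ler_norm.
by exists y.
Qed.

(** The image of the right half-plane under the Koenigs function contains, with
each of its points, the horizontal half-line issued from it to the right: along
the level curve of the imaginary part through the point, parametrised by the
real part of the variable, the real part of the function tends to infinity. *)
Lemma koenigs_shift z (v : R) : 0 < complex.Re z -> complex.Re (h z) <= v ->
  exists2 w, complex.Re z <= complex.Re w & h w = (v +i* complex.Im (h z))%C.
Proof.
case: z => x0 y0 z0 hv; set s := complex.Im (h _).
have /= x0p := ltW z0.
(* The level curve of Im h through x0 +i* y0 is the graph of Yf. *)
have [Yf hYf] : exists Yf : R -> R, forall x, 0 <= x -> complex.Im (h (x +i* Yf x)%C) = s.
  have /choice[Yf] : forall x, exists y, 0 <= x -> complex.Im (h (x +i* y)%C) = s.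
    move=> x; have [x_ge0|x_lt0] := leP 0 x; last by exists 0.
    by have [y hy] := Im_koenigs_surj s x_ge0; exists y.
  by exists Yf.
(* At abscissa X the real part of h is at least ln (1 + X), hence at least v. *)
pose X := Num.max x0 (expR v).
have x0X : x0 <= X by rewrite le_max lexx.
have X0 : 0 <= X := le_trans x0p x0X.
have [Y Y0 hY] := Im_koenigs_large `|s| X0.
have YfY x : 0 <= x <= X -> `|Yf x| <= Y.
  move=> xX; have x_ge0 : 0 <= x by case/andP: xX.
  rewrite leNgt; apply/negP; rewrite ltr_normr => /orP[|] /ltW /(hY _ _ xX).
    by rewrite hYf// ltNge ler_norm.
  by rewrite h_conj// hYf// ltNge -normrN ler_norm.
pose M := X + Y + `|y0|.
have normM x y : 0 <= x <= X -> `|y| <= Y + `|y0| -> normc (x +i* y)%C <= M.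
  move=> /andP[x_ge0 xX] yY; apply: le_trans (normc_le_ReIm _) _ => /=.
  by rewrite /M -addrA lerD// ger0_norm.
have y0M : `|y0| <= Y + `|y0| by rewrite lerDr.
have YM x : 0 <= x <= X -> `|Yf x| <= Y + `|y0|.
  by move=> /YfY/le_trans; apply; rewrite lerDl.
have Mp : 0 < (1 + M) ^+ 2 by rewrite exprn_gt0// ltr_wpDr// !addr_ge0.
(* Yf is Lipschitz: moving the abscissa from x to x' at the height Yf x' changes
   Im h by at most 4 * S * `|x' - x|, and h grows at a definite rate vertically. *)
pose K := (1 + M) ^+ 2 * (4 * S).
have K0 : 0 <= K.
  by rewrite /K; apply: mulr_ge0; [exact: ltW|rewrite mulr_ge0// (le_trans ler01)].
have YfK x x' : 0 <= x <= X -> 0 <= x' <= X -> `|Yf x' - Yf x| <= K * `|x' - x|.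
  move=> xX x'X; have /andP[x_ge0 _] := xX; have /andP[x'_ge0 _] := x'X.
  have [->|ne] := eqVneq (Yf x') (Yf x).
    by rewrite subrr normr0 mulr_ge0.
  have dp : 0 < `|Yf x' - Yf x| by rewrite normr_gt0 subr_eq0.
  have := Im_koenigs_vertical_mono x_ge0 (normM _ _ xX (YM _ xX)) (normM _ _ xX (YM _ x'X)).
  rewrite (hYf x)// -(hYf x')// -real_normK ?num_real// => H.
  rewrite -(ler_pM2l dp) -expr2; apply: le_trans H _.
  have -> : `|Yf x' - Yf x| * (K * `|x' - x|) =
      (1 + M) ^+ 2 * (`|Yf x' - Yf x| * (4 * S * `|x' - x|)) by rewrite /K; ring.
  rewrite ler_pM2l//.
  apply: le_trans (ler_norm _) _; rewrite normrM ler_pM2l//.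
  rewrite -ImN -ImD; apply: le_trans (Im_le_normc _) _.
  apply: le_trans (koenigs_lipschitz c_gt0 c_cvg _ _) _ => //.
  rewrite ler_wpM2l//; first by rewrite mulr_ge0// (le_trans ler01).
  by rewrite /= subrr [0 ^+ 2]expr0n addr0 sqrtr_sqr distrC.
have start : h (x0 +i* Yf x0)%C = h (x0 +i* y0)%C.
  have x0X' : 0 <= x0 <= X by rewrite x0p.
  have := Im_koenigs_vertical_mono x0p (normM _ _ x0X' y0M) (normM _ _ x0X' (YM _ x0X')).
  rewrite hYf// /s subrr !mulr0 => H.
  have /eqP : (Yf x0 - y0) ^+ 2 = 0 by apply/eqP; rewrite eq_le H sqr_ge0.
  by rewrite sqrf_eq0 subr_eq0 => /eqP ->.
have [||x xX hx] := @IVT_lipschitz R (fun x => complex.Re (h (x +i* Yf x)%C))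
    x0 X (4 * S * (1 + K)) v x0X.
- move=> x x' /andP[x0x xX] /andP[x0x' x'X].
  have x_ge0 := le_trans x0p x0x; have x'_ge0 := le_trans x0p x0x'.
  rewrite -ReN -ReD; apply: le_trans (Re_le_normc _) _.
  apply: le_trans (koenigs_lipschitz c_gt0 c_cvg _ _) _ => //.
  rewrite -/S -[leRHS]mulrA ler_wpM2l//; first by rewrite mulr_ge0// (le_trans ler01).
  apply: le_trans (normc_le_ReIm _) _ => /=.
  by rewrite mulrDl mul1r lerD2l YfK// ?x_ge0 ?x'_ge0.
- have Xc : 0 <= complex.Re (X +i* Yf X)%C by [].
  rewrite start hv andTb; apply: le_trans _ (Re_koenigs_ge c_gt0 c_0 c_cvg Xc).
  rewrite -[leLHS]expRK ler_ln ?posrE ?expR_gt0//; last first.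
    by rewrite (lt_le_trans ltr01)// normc_ge_Re//= lerDl.
  apply: normc_ge_Re => /=; apply: (@le_trans _ _ X); first by rewrite le_max lexx orbT.
  by rewrite lerDr.
have /andP[x0x _] := xX.
exists (x +i* Yf x)%C => //.
apply: complexP; first exact: hx.
by rewrite hYf// (le_trans x0p).
Qed.

(** Every horizontal line meets the image of the right half-plane. *)
Lemma koenigs_exhausts (p : R[i]) : exists2 z, 0 < complex.Re z &
  exists2 t : R, 0 <= t & h z = p + t%:C%C.
Proof.
case: p => u v; have [y hy] := Im_koenigs_surj v (@ler01 R).
pose a := complex.Re (h (1 +i* y)%C).
have [|w w1 hw] := @koenigs_shift (1 +i* y)%C (Num.max a u) ltr01.
  by rewrite le_max lexx.
exists w; first exact: lt_le_trans ltr01 w1.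
exists (Num.max a u - u); first by rewrite subr_ge0 le_max lexx orbT.
by rewrite hw hy; apply: complexP => /=; rewrite ?addr0// addrC subrK.
Qed.

End Shift.
(** * Holomorphy and uniform convergence through the modulus *)

Section ComplexTopology.
Context {R : realType}.
Implicit Types (z w d : R[i]) (f g : R[i] -> R[i]).

Lemma normc_norm z : `|z| = (normc z)%:C%C.
Proof. by case: z. Qed.

Lemma normr_ltC z (e : R) : (`|z| < e%:C%C) = (normc z < e).
Proof. by rewrite normc_norm ltcR. Qed.

Lemma normr_leC z (e : R) : (`|z| <= e%:C%C) = (normc z <= e).
Proof. by rewrite normc_norm lecR. Qed.

Lemma gt0_realC (e : R[i]) : 0 < e -> exists2 r : R, 0 < r & e = r%:C%C.
Proof.
by case: e => a b; rewrite ltcE /= => /andP[/eqP b0 a0]; exists a => //; rewrite b0.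
Qed.

Lemma near_normc z (e : R) : 0 < e -> \forall w \near z, normc (w - z) < e.
Proof.
move=> e0; apply/nbhs_normP; exists e%:C%C; first by rewrite /= ltcR.
by move=> w /=; rewrite normr_ltC normcB.
Qed.

(** Complex differentiability with a remainder of the second order, the form of
holomorphy that the estimates below yield directly. *)
Definition qdiff f z := exists d (e C : R), [/\ 0 < e, 0 <= C &
  forall w, normc (w - z) < e ->
    normc (f w - f z - d * (w - z)) <= C * normc (w - z) ^+ 2].

Lemma qdiff_derivable f z : qdiff f z -> derivable f z 1.
Proof.
move=> [d [e [C [e0 C0 H]]]]; apply/cvg_ex; exists d.
apply/cvgrPdist_le => _ /gt0_realC[r r0 ->].
have C1 : 0 < C + 1 by rewrite ltr_wpDl.
have er0 : 0 < Num.min e (r / (C + 1)) by rewrite lt_min e0 divr_gt0.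
have er0C : 0 < (Num.min e (r / (C + 1)))%:C%C by rewrite ltcR.
near=> h.
have hn0 : h != 0 by near: h; exact: nbhs_dnbhs_neq.
have : `|h| < (Num.min e (r / (C + 1)))%:C%C by near: h; exact: dnbhs0_lt.
rewrite normr_ltC lt_min => /andP[he hr].
have nh : 0 < normc h by rewrite normc_gt0.
rewrite normr_leC normcB.
have := H (h + z); rewrite addrK => /(_ he) Hh.
have -> : h^-1 *: ((f \o shift z) (h *: (1 : R[i])) - f z) - d =
    h^-1 * (f (h + z) - f z - d * h).
  have -> : h *: (1 : R[i]) = h by exact: mulr1.
  rewrite -[_ *: _]/(_ * _) /=; field; exact: hn0.
rewrite normcM normcV ler_pdivrMl//; apply: le_trans Hh _.
rewrite expr2 mulrA [leRHS]mulrC ler_pM2r//.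
apply: (@le_trans _ _ ((C + 1) * normc h)); first by rewrite ler_wpM2r ?normc_ge0// lerDl.
by rewrite mulrC -ler_pdivlMr// ltW.
Unshelve. all: by end_near. Qed.

Lemma qdiff_comp f g z : qdiff f z -> qdiff g (f z) -> qdiff (g \o f) z.
Proof.
move=> [d [e [C [e0 C0 H]]]] [d' [e' [C' [e'0 C'0 H']]]].
pose L := normc d + C; have L0 : 0 <= L by rewrite addr_ge0 ?normc_ge0.
have L1 : 0 < L + 1 by rewrite ltr_wpDl.
exists (d' * d), (Num.min (Num.min e 1) (e' / (L + 1))), (C' * L ^+ 2 + normc d' * C).
split.
- by rewrite !lt_min e0 ltr01 divr_gt0.
- by rewrite addr_ge0// mulr_ge0// ?normc_ge0// sqr_ge0.
move=> w; rewrite !lt_min => /andP[/andP[we w1] we'].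
have n0 := normc_ge0 (w - z); have Hw := H _ we.
have fL : normc (f w - f z) <= L * normc (w - z).
  have -> : f w - f z = d * (w - z) + (f w - f z - d * (w - z)) by ring.
  apply: le_trans (normcD _ _) _; rewrite normcM mulrDl lerD2l.
  apply: le_trans Hw _; rewrite ler_wpM2l// expr2 ler_piMl//; exact: ltW.
have fe' : normc (f w - f z) < e'.
  apply: le_lt_trans fL _; apply: (@le_lt_trans _ _ ((L + 1) * normc (w - z))).
    by rewrite ler_wpM2r// lerDl.
  by rewrite mulrC -ltr_pdivlMr.
have -> : (g \o f) w - (g \o f) z - d' * d * (w - z) =
   (g (f w) - g (f z) - d' * (f w - f z)) + d' * (f w - f z - d * (w - z)).
  by rewrite /=; ring.
apply: le_trans (normcD _ _) _; rewrite normcM mulrDl lerD//.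
  apply: le_trans (H' _ fe') _; rewrite -mulrA ler_wpM2l// -exprMn.
  by rewrite ler_sqr ?nnegrE ?normc_ge0// mulr_ge0.
by rewrite -mulrA ler_wpM2l// normc_ge0.
Qed.

Lemma qdiff_affine a b z : qdiff (fun w => a * w + b) z.
Proof.
exists a, 1, 0; split => // w _; rewrite mul0r (_ : _ - _ = 0) ?normc0//.
by ring.
Qed.

Lemma qdiff_inv z : z != 0 -> qdiff (fun w => w^-1) z.
Proof.
move=> z0; have nz : 0 < normc z by rewrite normc_gt0.
exists (- z ^- 2), (normc z / 2), (2 / normc z ^+ 3); split.
- by rewrite divr_gt0.
- by rewrite divr_ge0// exprn_ge0// ltW.
move=> w wz.
have nw : normc z / 2 <= normc w.
  have := normcD (z - w) w; rewrite subrK normcB => zw; lra.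
have w0 : w != 0 by rewrite -normc_gt0; apply: lt_le_trans nw; rewrite divr_gt0.
have -> : w^-1 - z^-1 - - z ^- 2 * (w - z) = (w - z) ^+ 2 / (w * z ^+ 2).
  by field; rewrite z0.
have nX (u : R[i]) : normc (u ^+ 2) = normc u ^+ 2 by rewrite !expr2 normcM.
rewrite [X in X <= _]normcM normcV [normc (w * _)]normcM !nX mulrC.
rewrite ler_wpM2r ?exprn_ge0 ?normc_ge0//.
have -> : 2 / normc z ^+ 3 = (normc z / 2 * normc z ^+ 2)^-1.
  by field; rewrite gt_eqF.
rewrite lef_pV2 ?posrE ?mulr_gt0 ?exprn_gt0//.
- by rewrite ler_wpM2r// exprn_ge0// normc_ge0.
- by apply: lt_le_trans nw; rewrite divr_gt0.
Qed.

(** Uniform convergence on a set, in terms of the modulus. *)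
Lemma cvg_uniform_normc (K : set R[i]) (F : set_system (R[i] -> R[i])) f :
  Filter F ->
  (forall e : R, 0 < e -> F [set g | forall z, K z -> normc (f z - g z) < e]) ->
  {uniform K, F --> f}.
Proof.
move=> FF H P /uniform_nbhs[E [entE sub]].
move: entE; rewrite -entourage_ballE => -[_ /= /gt0_realC[e e0 ->] eE].
apply: filterS (H e e0) => g gK; apply: sub => z Kz; apply: eE.
by rewrite /= /ball /= normr_ltC; exact: gK.
Qed.

End ComplexTopology.
(** * The Cayley transform *)

(** The Cayley transform [(1 + z) / (1 - z)], from the unit disk onto the right
half-plane, in a form that makes it a bijection of the whole plane: as [0^-1 = 0], it
sends [1] to [-1], which the inverse below sends back to [1]. *)
Definition cayley {R : realType} (z : R[i]) : R[i] := 2 * (1 - z)^-1 - 1.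

(** The inverse [(w - 1) / (w + 1)] of the Cayley transform. *)
Definition uncayley {R : realType} (w : R[i]) : R[i] := 1 - 2 * (w + 1)^-1.

Section Cayley.
Context {R : realType}.
Implicit Types z w : R[i].

Lemma unit_diskE z : unit_disk R z <-> normc z < 1.
Proof. by rewrite /unit_disk /= -[1]/((1 : R)%:C%C) normr_ltC. Qed.

Lemma disk_subr_neq0 z : normc z < 1 -> 1 - z != 0.
Proof.
by move=> z1; apply/eqP => /subr0_eq e; move: z1; rewrite -e normc1 ltxx.
Qed.

Lemma half_plane_neq0 w : 0 < complex.Re w -> w + 1 != 0.
Proof.
move=> w0; rewrite -normc_gt0; apply: lt_le_trans ltr01 (normc_ge_Re _).
by rewrite ReD /= lerDr ltW.
Qed.

Lemma cayleyE z : normc z < 1 -> cayley z = (1 + z) / (1 - z).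
Proof. by move=> /disk_subr_neq0 z1; rewrite /cayley; field. Qed.

Lemma uncayleyE w : 0 < complex.Re w -> uncayley w = (w - 1) / (w + 1).
Proof. by move=> /half_plane_neq0 w1; rewrite /uncayley; field. Qed.

Lemma Re_cayley z : normc z < 1 ->
  complex.Re (cayley z) = (1 - normc z ^+ 2) / normc (1 - z) ^+ 2.
Proof.
move=> /cayleyE ->.
by rewrite ReM ReV ImV !normc_sqr; case: z => x y /=; ring. Qed.

Lemma cayley_gt0 z : normc z < 1 -> 0 < complex.Re (cayley z).
Proof.
move=> z1; rewrite Re_cayley// divr_gt0 ?exprn_gt0 ?normc_gt0 ?disk_subr_neq0//.
by rewrite subr_gt0 expr_lt1 ?normc_ge0.
Qed.

Lemma uncayley_lt1 w : 0 < complex.Re w -> normc (uncayley w) < 1.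
Proof.
move=> w0; have w1 := half_plane_neq0 w0.
rewrite uncayleyE// normcM normcV ltr_pdivrMr ?normc_gt0// mul1r.
rewrite -ltr_sqr ?nnegrE ?normc_ge0// !normc_sqr !ReD !ImD ReN ImN /=.
by case: w w0 {w1} => x y /= x0; rewrite oppr0 ltrD2r; nra.
Qed.

Lemma cayleyK z : cayley (uncayley z) = z.
Proof.
have n2 : (2 : R[i]) != 0 by rewrite pnatr_eq0.
by rewrite /uncayley /cayley opprB addrCA subrr addr0 invfM invrK mulrA mulfV// mul1r addrK.
Qed.

Lemma uncayleyK z : uncayley (cayley z) = z.
Proof.
have n2 : (2 : R[i]) != 0 by rewrite pnatr_eq0.
by rewrite /uncayley /cayley subrK invfM invrK mulrA mulfV// mul1r subKr.
Qed.

Lemma qdiff_cayley z : normc z < 1 -> qdiff cayley z.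
Proof.
move=> z1.
have -> : cayley = (fun w : R[i] => 2 * w + -1) \o ((fun w => w^-1) \o
    (fun w : R[i] => -1 * w + 1)).
  by apply/funext => u; rewrite /cayley /= mulN1r [- u + 1]addrC.
apply: qdiff_comp; last exact: qdiff_affine.
apply: qdiff_comp; first exact: qdiff_affine.
by apply: qdiff_inv; rewrite mulN1r addrC disk_subr_neq0.
Qed.

Lemma qdiff_uncayley w : 0 < complex.Re w -> qdiff uncayley w.
Proof.
move=> w0.
have -> : uncayley = (fun w : R[i] => -2 * w + 1) \o ((fun w => w^-1) \o
    (fun w : R[i] => 1 * w + 1)).
  by apply/funext => u; rewrite /uncayley /= mul1r addrC mulNr.
apply: qdiff_comp; last exact: qdiff_affine.
apply: qdiff_comp; first exact: qdiff_affine.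
by apply: qdiff_inv; rewrite mul1r half_plane_neq0.
Qed.

Lemma uncayley_lipschitz w w' : 0 < complex.Re w -> 0 < complex.Re w' ->
  normc (uncayley w' - uncayley w) <= 2 * normc (w' - w).
Proof.
move=> w0 w'0; have w1 := half_plane_neq0 w0; have w'1 := half_plane_neq0 w'0.
have -> : uncayley w' - uncayley w = 2 * (w' - w) / ((w' + 1) * (w + 1)).
  by rewrite /uncayley; field; rewrite w1 w'1.
have n1 (u : R[i]) : 0 < complex.Re u -> 1 <= normc (u + 1).
  by move=> u0; apply: (@normc_ge_Re _ _ 1); rewrite ReD /= lerDr ltW.
rewrite normcM normcM normcV normcM.
have -> : normc (2 : R[i]) = 2.
  by rewrite (_ : 2 = 2%:C%C) ?normc_real ?ger0_norm// rmorph_nat.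
rewrite ler_pdivrMr; last by rewrite mulr_gt0// (lt_le_trans ltr01)// n1.
rewrite ler_peMr ?mulr_ge0 ?normc_ge0//.
by rewrite -[1]mulr1 ler_pM// n1.
Qed.

(** The Cayley transform is bounded on compact subsets of the disk. *)
Lemma cayley_bounded_on_compact (K : set R[i]) : K `<=` unit_disk R -> compact K ->
  exists M : R, forall z, K z -> normc (cayley z) <= M.
Proof.
move=> KD /compact_near_coveringP/(_ R +oo (fun M z => normc (cayley z) <= M)) H.
have : \forall M \near +oo, K `<=` (fun z => normc (cayley z) <= M).
  apply: H => z /KD/unit_diskE z1.
  have n0 : 0 < normc (1 - z) by rewrite normc_gt0 disk_subr_neq0.
  have n2 : 0 < normc (1 - z) / 2 by rewrite divr_gt0.
  (* B bounds the Cayley transform on the ball of radius normc (1 - z) / 2. *)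
  pose B := (1 + normc z + normc (1 - z)) / (normc (1 - z) / 2).
  exists ([set w | normc (w - z) < normc (1 - z) / 2], [set M | B <= M]).
    split; first exact: near_normc.
    by apply: nbhs_pinfty_ge; exact: num_real.
  move=> [w M] [/= wz BM]; apply: le_trans BM.
  have lo : normc (1 - z) / 2 <= normc (1 - w).
    have := normcD (1 - w) (w - z).
    rewrite (_ : 1 - w + (w - z) = 1 - z); last by ring.
    lra.
  have w1 : 1 - w != 0 by rewrite -normc_gt0 (lt_le_trans n2).
  have -> : cayley w = (1 + w) / (1 - w) by rewrite /cayley; field.
  rewrite normcM normcV /B.
  have up : normc (1 + w) <= 1 + normc z + normc (1 - z).
    have -> : 1 + w = 1 + z + (w - z) by ring.
    apply: le_trans (normcD _ _) _; apply: lerD; last by lra.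
    by have := normcD (1 : R[i]) z; rewrite normc1.
  rewrite ler_pM ?invr_ge0 ?normc_ge0// lef_pV2 ?posrE//.
  exact: lt_le_trans lo.
by move=> /filter_ex[M HM]; exists M.
Qed.

End Cayley.
(** * The semigroup *)

Section Semigroup.
Context {R : realType} (c : nat -> R).
Hypothesis c_gt0 : forall k, 0 < c k.
Hypothesis c_le1 : forall k, c k <= 1.
Hypothesis c_0 : c 0%N = 1.
Hypothesis c_cvg : cvgn (series c).
Let S := limn (series c).
Implicit Types z w : R[i].
Local Notation h := (koenigs c).

Let S_ge1 : 1 <= S. Proof. exact: (sum_c_ge1 c_gt0 c_0). Qed.
Let S4_ge0 : 0 <= 4 * S. Proof. by rewrite mulr_ge0// (le_trans ler01). Qed.

(** The semigroup in the right half-plane, which the Koenigs function conjugates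
to the translations by positive reals; the value [0] stands where there is no such
point. *)
Definition flow (t : R) (z : R[i]) : R[i] :=
  xget 0 [set w | 0 < complex.Re w /\ h w = h z + t%:C%C].

Lemma flowP t z : 0 <= t -> 0 < complex.Re z ->
  0 < complex.Re (flow t z) /\ h (flow t z) = h z + t%:C%C.
Proof.
move=> t0 z0; rewrite /flow.
have [w zw hw] := @koenigs_shift _ c c_gt0 c_le1 c_0 c_cvg z (complex.Re (h z) + t) z0
  (ltac:(by rewrite lerDl)).
apply: (@xgetPex _ 0 [set w | 0 < complex.Re w /\ h w = h z + t%:C%C]).
exists w; split; first exact: lt_le_trans zw.
by rewrite hw; apply: complexP; rewrite (ReD, ImD) ?addr0.
Qed.

Lemma flow_gt0 t z : 0 <= t -> 0 < complex.Re z -> 0 < complex.Re (flow t z).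
Proof. by move=> t0 /(flowP t0)[]. Qed.

Lemma koenigs_flow t z : 0 <= t -> 0 < complex.Re z -> h (flow t z) = h z + t%:C%C.
Proof. by move=> t0 /(flowP t0)[]. Qed.

Lemma flow_unique t z w : 0 <= t -> 0 < complex.Re z -> 0 < complex.Re w ->
  h w = h z + t%:C%C -> flow t z = w.
Proof.
move=> t0 z0 w0 hw; have [f0 hf] := flowP t0 z0.
by apply: (koenigs_inj c_gt0 c_0 c_cvg (ltW f0) (ltW w0)); rewrite hf hw.
Qed.

(** A bound for the flow up to time [t] on the ball of radius [M]. *)
Definition flow_bound (M t : R) := expR (4 * S * M + t) + 1.

Lemma flow_bound_ge0 M t : 0 <= flow_bound M t.
Proof. by rewrite addr_ge0// expR_ge0. Qed.

Lemma flow_le t z M T : 0 <= t -> 0 < complex.Re z -> normc z <= M -> t <= T ->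
  normc (flow t z) <= flow_bound M T.
Proof.
move=> t0 z0 zM tT; have [f0 hf] := flowP t0 z0.
have := Re_koenigs_ge c_gt0 c_0 c_cvg (ltW f0); rewrite hf ReD [complex.Re _%:C%C]/= => lnle.
have n1 : 1 <= normc (1 + flow t z) by apply: normc_ge_Re; rewrite ReD /= lerDl ltW.
have : normc (1 + flow t z) <= expR (4 * S * M + T).
  rewrite -[leLHS]lnK ?posrE ?(lt_le_trans ltr01)// ler_expR; apply: le_trans lnle _.
  rewrite lerD//; apply: le_trans (ler_norm _) _; apply: le_trans (Re_le_normc (h z)) _.
  by apply: le_trans (koenigs_le c_gt0 c_cvg (ltW z0)) _; rewrite ler_wpM2l.
move=> H; have := normcD (1 + flow t z) (- 1).
rewrite normcN normc1 (_ : 1 + flow t z + -1 = flow t z); last by ring.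
by move=> /le_trans; apply; rewrite lerD2r.
Qed.

Lemma flow_lipschitz_time M T t s z : 0 <= t <= T -> 0 <= s <= T ->
  0 < complex.Re z -> normc z <= M ->
  normc (flow t z - flow s z) <= (1 + flow_bound M T) ^+ 2 * `|t - s|.
Proof.
move=> /andP[t0 tT] /andP[s0 sT] z0 zM.
have [ft ht] := flowP t0 z0; have [fs hs] := flowP s0 z0.
have := koenigs_inv_lipschitz c_gt0 c_0 c_cvg (ltW fs) (ltW ft)
  (flow_le s0 z0 zM sT) (flow_le t0 z0 zM tT).
rewrite ht hs (_ : _ + _ - _ = (t - s)%:C%C) ?normc_real//.
by rewrite rmorphB /=; ring.
Qed.

Lemma qdiff_koenigs z : 0 < complex.Re z -> qdiff h z.
Proof.
move=> z0; exists (dkoenigs c z), (complex.Re z), (4 * S); split => // w wz.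
apply: koenigs_taylor => //; first exact: ltW.
have := le_lt_trans (Re_le_normc _) wz; rewrite ReD ReN ltr_norml => /andP[+ _].
by rewrite ltrBrDr addNr => /ltW.
Qed.

(** As [h (flow t z) = h z + t], the derivative of [flow t] at [z] is the quotient of
those of [h] at [z] and at [flow t z]. *)
Lemma qdiff_flow t z : 0 <= t -> 0 < complex.Re z -> qdiff (flow t) z.
Proof.
move=> t0 z0; have [f0 hf] := flowP t0 z0.
set d := dkoenigs c z; set d' := dkoenigs c (flow t z).
have d'0 : d' != 0.
  apply/eqP => e; have := Re_dkoenigs_gt0 c_gt0 c_cvg (ltW f0).
  by rewrite -/d' e /= ltxx.
pose B := flow_bound (normc z + 1) t.
pose L := (1 + B) ^+ 2 * (4 * S).
have L0 : 0 <= L by rewrite mulr_ge0// sqr_ge0.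
exists (d / d'), (Num.min 1 (complex.Re z)), ((normc d')^-1 * (4 * S * L ^+ 2 + 4 * S)).
split.
- by rewrite lt_min ltr01.
- by rewrite mulr_ge0 ?invr_ge0 ?normc_ge0// addr_ge0// mulr_ge0// sqr_ge0.
move=> w; rewrite lt_min => /andP[w1 wz].
have w0 : 0 < complex.Re w.
  have := le_lt_trans (Re_le_normc _) wz; rewrite ReD ReN ltr_norml => /andP[+ _].
  by rewrite ltrBrDr addNr.
have [fw hw] := flowP t0 w0.
have zB : normc (flow t z) <= B by apply: flow_le => //; rewrite lerDl.
have wB : normc (flow t w) <= B.
  apply: flow_le => //; have := normcD (w - z) z; rewrite subrK => /le_trans; apply.
  by rewrite addrC lerD2l ltW.
have hwz : h (flow t w) - h (flow t z) = h w - h z by rewrite hw hf; ring.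
have fL : normc (flow t w - flow t z) <= L * normc (w - z).
  apply: le_trans (koenigs_inv_lipschitz c_gt0 c_0 c_cvg (ltW f0) (ltW fw) zB wB) _.
  rewrite hwz /L -mulrA ler_wpM2l ?sqr_ge0//.
  exact: (koenigs_lipschitz c_gt0 c_cvg (ltW z0) (ltW w0)).
have Tz := koenigs_taylor c_gt0 c_le1 c_cvg (ltW z0) (ltW w0).
have Tf := koenigs_taylor c_gt0 c_le1 c_cvg (ltW f0) (ltW fw).
have -> : flow t w - flow t z - d / d' * (w - z) = d'^-1 *
   ((h w - h z - d * (w - z)) +
    - (h (flow t w) - h (flow t z) - d' * (flow t w - flow t z))).
  by rewrite hwz; field.
rewrite normcM normcV -[leRHS]mulrA ler_wpM2l ?invr_ge0 ?normc_ge0//.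
apply: le_trans (normcD _ _) _; rewrite normcN mulrDl [leLHS]addrC.
apply: lerD; last exact: Tz.
apply: le_trans Tf _; rewrite -[leRHS]mulrA ler_wpM2l// -exprMn.
have nL : 0 <= L * normc (w - z) by apply: mulr_ge0 => //; exact: normc_ge0.
by rewrite ler_sqr ?nnegrE ?normc_ge0.
Qed.

(** The semigroup of the unit disk. *)
Definition disk_flow (t : R) (z : R[i]) : R[i] := uncayley (flow t (cayley z)).

(** The Koenigs function of the unit disk; the factor [i] turns the translations by
[t] into the translations by [i t]. *)
Definition disk_koenigs (z : R[i]) : R[i] := (0 +i* 1)%C * h (cayley z).

Lemma mul_i_real (t : R) : (0 +i* 1)%C * t%:C%C = (0 +i* t)%C.
Proof. by apply: complexP; rewrite (ReM, ImM) /=; ring. Qed.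

Lemma disk_flow_unit t z : 0 <= t -> unit_disk R z -> unit_disk R (disk_flow t z).
Proof.
move=> t0 /unit_diskE z1; apply/unit_diskE; apply: uncayley_lt1.
by apply: flow_gt0 => //; exact: cayley_gt0.
Qed.

Lemma disk_koenigs_flow t z : 0 <= t -> unit_disk R z ->
  disk_koenigs (disk_flow t z) = disk_koenigs z + (0 +i* t)%C.
Proof.
move=> t0 /unit_diskE z1; rewrite /disk_koenigs /disk_flow cayleyK koenigs_flow//.
  by rewrite mulrDr mul_i_real.
exact: cayley_gt0.
Qed.

Lemma disk_koenigs_inj : set_inj (unit_disk R) disk_koenigs.
Proof.
move=> z w /[1!inE]/unit_diskE z1 /[1!inE]/unit_diskE w1 /mulfI e.
have {}e : h (cayley z) = h (cayley w).
  by apply: e; rewrite eq_complex /= oner_eq0 andbF.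
rewrite -(uncayleyK z) -(uncayleyK w); congr uncayley.
by apply: (koenigs_inj c_gt0 c_0 c_cvg) e; rewrite ltW// cayley_gt0.
Qed.

Lemma disk_koenigs_holo : holomorphic_on (unit_disk R) disk_koenigs.
Proof.
move=> z /unit_diskE z1; apply: qdiff_derivable.
have -> : disk_koenigs = (fun w => (0 +i* 1)%C * w + 0) \o (h \o cayley).
  by apply/funext => w; rewrite /= addr0.
apply: qdiff_comp; last exact: qdiff_affine.
by apply: qdiff_comp; [exact: qdiff_cayley|apply: qdiff_koenigs; exact: cayley_gt0].
Qed.

Lemma disk_flow_holo t : 0 <= t -> holomorphic_on (unit_disk R) (disk_flow t).
Proof.
move=> t0 z /unit_diskE z1; apply: qdiff_derivable.
have c0 := cayley_gt0 z1.
apply: (@qdiff_comp _ (flow t \o cayley) uncayley).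
  by apply: qdiff_comp; [exact: qdiff_cayley|exact: qdiff_flow].
by apply: qdiff_uncayley; exact: flow_gt0.
Qed.

Lemma disk_flow_continuous : {within `[0, +oo[, continuous
  (disk_flow : R -> {family compactly_in (unit_disk R), R[i] -> R[i]})}.
Proof.
apply/subspace_continuousP => t; rewrite /= in_itv /= andbT => t0.
apply/fam_cvgP => K [KD cK]; apply: cvg_uniform_normc => e e0.
have [M KM] := cayley_bounded_on_compact KD cK.
pose L := 2 * (1 + flow_bound M (t + 1)) ^+ 2.
have L0 : 0 < L by rewrite mulr_gt0// exprn_gt0// ltr_wpDr// flow_bound_ge0.
have near1 : \forall s \near t, `|t - s| < Num.min 1 (e / L).
  apply: (@cvgr_dist_lt _ _ _ (nbhs t) _ id); first exact: cvg_id.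
  by rewrite lt_min ltr01 divr_gt0.
change (nbhs t [set s | `[0, +oo[%classic s -> forall z, K z ->
  normc (disk_flow t z - disk_flow s z) < e]).
apply: filterS near1 => s + s0 z Kz.
rewrite /= in_itv /= andbT in s0.
rewrite lt_min => /andP[ts1 tse].
have z1 := KD z Kz; have /unit_diskE/cayley_gt0 c0 := z1.
have st1 : s <= t + 1.
  by move: ts1; rewrite ltr_norml => /andP[]; lra.
rewrite /disk_flow; apply: le_lt_trans (uncayley_lipschitz _ _) _; [exact: flow_gt0..|].
have := @flow_lipschitz_time M (t + 1) t s (cayley z).
rewrite t0 s0 st1 lerDl ler01 => /(_ isT isT c0 (KM z Kz)) H.
apply: (@le_lt_trans _ _ (L * `|t - s|)); first by rewrite /L -[leRHS]mulrA ler_wpM2l.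
by rewrite mulrC -ltr_pdivlMr.
Qed.

Lemma disk_flow_semigroup : nonelliptic_semigroup disk_flow.
Proof.
have inj := disk_koenigs_inj.
split.
- exact: disk_flow_holo.
- exact: disk_flow_unit.
- move=> z z1; apply: inj; rewrite ?inE//; first exact: disk_flow_unit.
  by rewrite disk_koenigs_flow// (_ : (0 +i* 0)%C = 0) ?addr0.
- move=> s t z s0 t0 z1; have st0 : 0 <= t + s by rewrite addr_ge0.
  have fs := disk_flow_unit s0 z1.
  apply: inj; [by rewrite inE; exact: disk_flow_unit..|].
  rewrite (disk_koenigs_flow st0 z1) (disk_koenigs_flow t0 fs) (disk_koenigs_flow s0 z1).
  rewrite -addrA; congr (_ + _).
  by apply: complexP => /=; rewrite ?addr0// addrC.
- exact: disk_flow_continuous.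
- move=> t z t0 z1 e; have := disk_koenigs_flow (ltW t0) z1.
  rewrite e -[LHS]addr0 => /addrI[] t00.
  by move: t0; rewrite -t00 ltxx.
Qed.

Lemma disk_flow_model : holomorphic_model disk_flow setT disk_koenigs.
Proof.
split.
- by split; [exact: disk_koenigs_holo|exact: disk_koenigs_inj].
- move=> t t0 _ [_ [z z1 <-] <-]; exists (disk_flow t z).
    exact: disk_flow_unit.
  exact: disk_koenigs_flow.
- exact: disk_koenigs_flow.
- apply/seteqP; split => // p _.
  have [z z0 [t t0 hz]] := koenigs_exhausts c_gt0 c_le1 c_0 c_cvg ((0 -i* 1)%C * p).
  exists t => //; exists (p + (0 +i* t)%C); last by rewrite addrK.
  exists (uncayley z); first by apply/unit_diskE; exact: uncayley_lt1.
  rewrite /disk_koenigs cayleyK hz mulrDr mul_i_real mulrA.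
  rewrite (_ : (0 +i* 1)%C * (0 -i* 1)%C = 1) ?mul1r//.
  by apply: complexP => /=; ring.
- exact: Or44.
Qed.

(** The orbit of the origin is real: in the half-plane it runs through the reals [X]
greater than [1], at hyperbolic distance [(ln X) / 2] from [1]. *)
Lemma total_speed_disk_flow (X : R) : 1 <= X ->
  let t := complex.Re (h X%:C%C) - complex.Re (h 1) in
  0 <= t -> total_speed disk_flow t = 2^-1 * ln X.
Proof.
move=> X1 t t0; have X0 : 0 < X := lt_le_trans ltr01 X1.
have c0 : cayley (0 : R[i]) = 1.
  by rewrite /cayley subr0 invr1 mulr1 mulr2n addrK.
have Im0 (x : R) : 0 <= x -> complex.Im (h x%:C%C) = 0.
  move=> x0; have := @Im_koenigs_conj _ c c_gt0 c_cvg x%:C%C x0.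
  by rewrite conjc_real => e; lra.
have hX : h X%:C%C = h 1 + t%:C%C.
  have I1 : complex.Im (h 1) = 0 by exact: (Im0 1 ler01).
  apply: complexP; rewrite (ReD, ImD); first by rewrite [complex.Re t%:C%C]/= /t addrC subrK.
  by rewrite I1 Im0 ?ltW// addr0.
have fX : flow t 1 = X%:C%C by apply: flow_unique => //=.
have e : disk_flow t 0 = ((X - 1) / (X + 1))%:C%C.
  rewrite /disk_flow c0 fX uncayleyE//.
  by rewrite fmorph_div /= rmorphB rmorphD rmorph1.
rewrite /total_speed /hyp_dist e /moebius.
have -> : (0 - ((X - 1) / (X + 1))%:C%C) / (1 - 0^* * ((X - 1) / (X + 1))%:C%C) =
   - ((X - 1) / (X + 1))%:C%C :> R[i].
  by rewrite rmorph0 mul0r subr0 invr1 mulr1 sub0r.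
rewrite normcN normc_real ger0_norm; last by rewrite divr_ge0 ?subr_ge0// addr_ge0// ltW.
congr (_ * ln _); field.
by rewrite gt_eqF ?addr_gt0//=; lra.
Qed.

End Semigroup.
(** * Sparse coefficients and the growth of the speed *)

Section Sparse.
Context {R : realType} (T : nat -> R).

(** The logarithms of the points [X_n] at which the speed is measured. They increase
with [n], start from [0], and for positive [n] are larger than [T n + 8], where [8]
bounds the value of the Koenigs function at [1]. *)
Definition sparse_log n : R := \sum_(j < n) (`|T j.+1| + 10).

(** Coefficients decreasing so fast that, on the scale [expR (sparse_log n)],
only the first [n.+1] terms of the series of the Koenigs function matter. *)
Definition sparse_coef k : R := (2 ^+ k * expR (sparse_log k))^-1.

Local Notation c := sparse_coef.
Local Notation X n := (expR (sparse_log n)).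

Lemma sparse_log_ge0 n : 0 <= sparse_log n.
Proof. by apply: sumr_ge0 => j _; rewrite addr_ge0. Qed.

Lemma sparse_log_ge n : `|T n.+1| + 10 <= sparse_log n.+1.
Proof. by rewrite /sparse_log big_ord_recr /= lerDr; exact: sparse_log_ge0. Qed.

Lemma sparse_log_homo m n : (m <= n)%N -> sparse_log m <= sparse_log n.
Proof.
move=> /subnK <-; elim: (n - m)%N => // k IH; apply: le_trans IH _.
by rewrite /sparse_log addSn big_ord_recr /= lerDl addr_ge0.
Qed.

Let X_ge1 n : 1 <= X n. Proof. by rewrite -expR0 ler_expR sparse_log_ge0. Qed.

Let pow_gt0 k : 0 < 2 ^+ k :> R. Proof. by rewrite exprn_gt0. Qed.

Lemma sparse_coef_gt0 k : 0 < c k.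
Proof. by rewrite invr_gt0 mulr_gt0// expR_gt0. Qed.

Lemma sparse_coef_le k n : (n <= k)%N -> c k * X n <= (2 ^+ k)^-1.
Proof.
move=> nk; rewrite /sparse_coef invfM -mulrA ler_piMr ?invr_ge0 ?(ltW (pow_gt0 k))//.
by rewrite mulrC ler_pdivrMr ?expR_gt0// mul1r ler_expR sparse_log_homo.
Qed.

Lemma sparse_log0 : sparse_log 0 = 0. Proof. by rewrite /sparse_log big_ord0. Qed.

Lemma sparse_coef_le_pow k : c k <= (2 ^+ k)^-1.
Proof. by have := sparse_coef_le (leq0n k); rewrite sparse_log0 expR0 mulr1. Qed.

Lemma sparse_coef_le1 k : c k <= 1.
Proof.
apply: le_trans (sparse_coef_le_pow k) _.
by rewrite invf_le1// exprn_ege1// ler1n.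
Qed.

Lemma sparse_coef_0 : c 0%N = 1.
Proof. by rewrite /sparse_coef sparse_log0 expR0 mulr1 expr0 invr1. Qed.

Let sum_pow n : \sum_(k < n) (2 ^+ k)^-1 <= 2 :> R.
Proof.
have -> : \sum_(k < n) (2 ^+ k)^-1 = 2 - 2 / 2 ^+ n :> R.
  elim: n => [|n IH]; first by rewrite big_ord0 expr0 divr1 subrr.
  by rewrite big_ord_recr /= IH exprS; field; rewrite gt_eqF.
by rewrite gerBl divr_ge0// ltW.
Qed.

Let sum_coef n : \sum_(k < n) c k <= 2.
Proof. by apply: le_trans (sum_pow n); apply: ler_sum => k _; exact: sparse_coef_le_pow. Qed.

Lemma sparse_coef_cvg : cvgn (series c).
Proof.
apply: nondecreasing_is_cvgn.
  by apply: nondecreasing_series => k _ _; rewrite ltW// sparse_coef_gt0.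
by exists 2 => _ [n _ <-]; rewrite /series /= big_mkord.
Qed.

Let lim_series_le_bound (u : nat -> R) (B : R) : cvgn (series u) ->
  (forall n, \sum_(k < n) u k <= B) -> limn (series u) <= B.
Proof.
move=> cu uB; apply: limr_le => //; apply: nearW => n.
by rewrite /series /= big_mkord.
Qed.

Let h := koenigs c.

Lemma koenigs_sparse_1 : 0 <= complex.Re (h 1) <= 8.
Proof.
have R1 : 0 <= complex.Re (1 : R[i]) by rewrite /= ler01.
apply/andP; split.
  apply: le_trans (Re_koenigs_ge sparse_coef_gt0 sparse_coef_0 sparse_coef_cvg R1).
  by apply: ln_ge0; apply: normc_ge_Re; rewrite ReD /= lerDl.
apply: le_trans (ler_norm _) _; apply: le_trans (Re_le_normc _) _.
apply: le_trans (koenigs_le sparse_coef_gt0 sparse_coef_cvg R1) _.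
rewrite normc1 mulr1.
have := lim_series_le_bound sparse_coef_cvg sum_coef; lra.
Qed.

Lemma koenigs_sparse_ge n : sparse_log n <= complex.Re (h (X n)%:C%C).
Proof.
have R1 : 0 <= complex.Re (X n)%:C%C by rewrite /= expR_ge0.
apply: le_trans (Re_koenigs_ge sparse_coef_gt0 sparse_coef_0 sparse_coef_cvg R1).
have n1 : X n <= normc (1 + (X n)%:C%C) by apply: normc_ge_Re; rewrite ReD /= lerDr.
by rewrite -[leLHS]expRK ler_ln ?posrE ?expR_gt0// (lt_le_trans _ n1)// expR_gt0.
Qed.

Lemma koenigs_sparse_le n :
  complex.Re (h (X n)%:C%C) <= n.+1%:R * (sparse_log n + 1) + 2.
Proof.
have X0 := expR_ge0 (sparse_log n).
have e k : complex.Re (clog (1 + (c k)%:C%C * (X n)%:C%C)) = ln (1 + c k * X n).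
  rewrite -rmorphM -(rmorph1 (real_complex R)) -rmorphD /= expr0n addr0 sqrtr_sqr ger0_norm//.
  by rewrite addr_ge0// mulr_ge0// ltW// sparse_coef_gt0.
have d := dominated_koenigs sparse_coef_gt0 (z := (X n)%:C%C) X0.
apply: lim_series_le_bound => [|m]; first exact: (dominated_Re sparse_coef_cvg d).
under eq_bigr do rewrite e.
have l1 : ln (1 + X n) <= sparse_log n + 1.
  apply: (@le_trans _ _ (ln (X n * (1 + 1)))).
    rewrite ler_ln ?posrE ?mulr_gt0 ?addr_gt0 ?expR_gt0//.
    by rewrite mulrDr mulr1 lerD2r.
  rewrite lnM ?posrE ?expR_gt0 ?addr_gt0// expRK lerD2l.
  by apply: le_ln1Dx; lra.
have l0 : 0 <= sparse_log n + 1 by rewrite addr_ge0// sparse_log_ge0.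
(* The terms k <= n are each at most ln (1 + X n), as c k <= 1; the other ones are
   at most c k * X n, hence at most (2 ^+ k)^-1. *)
apply: (@le_trans _ _ (\sum_(k < m)
    ((if (k <= n)%N then sparse_log n + 1 else 0) + (2 ^+ k)^-1))).
  apply: ler_sum => k _; have ck := ltW (sparse_coef_gt0 k).
  have cX0 : 0 <= c k * X n by rewrite mulr_ge0.
  case: leqP => kn.
    apply: (@le_trans _ _ (ln (1 + X n))).
      rewrite ler_ln ?posrE ?ltr_wpDr// lerD2l ler_piMl//.
      exact: sparse_coef_le1.
    by rewrite -[leLHS]addr0 lerD// invr_ge0 ltW.
  rewrite add0r; apply: le_trans (sparse_coef_le (ltnW kn)).
  by apply: le_ln1Dx; apply: lt_le_trans cX0; rewrite ltrN10.
rewrite big_split /= lerD//; last exact: sum_pow.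
have -> : \sum_(k < m) (if (k <= n)%N then sparse_log n + 1 else 0) =
    (minn m n.+1)%:R * (sparse_log n + 1).
  elim: m => [|m IH]; first by rewrite big_ord0 min0n mul0r.
  rewrite big_ord_recr /= IH; case: leqP => mn.
    rewrite (minn_idPl (leqW mn)) (minn_idPl (_ : m.+1 <= n.+1)%N)//.
    by rewrite -[m.+1]addn1 natrD mulrDl mul1r.
  by rewrite addr0 (minn_idPr mn) (minn_idPr (leqW mn)).
by rewrite ler_wpM2r// ler_nat geq_minr.
Qed.

End Sparse.

(** A real function that takes arbitrarily large values arbitrarily far has infinite
upper limit. *)
Lemma limf_esup_pinfty {R : realType} (f : R -> R) :
  (forall A M : R, exists2 t, M < t & A <= f t) ->
  limf_esup (fun t => (f t)%:E) +oo = +oo%E.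
Proof.
move=> H; apply/eqP; rewrite -leye_eq; apply: le_ereal_inf_tmp => _ [V [M [_ MV]] <-].
rewrite leye_eq; apply/eqP/eq_infty => A.
have [t Mt At] := H A M.
apply: (@le_trans _ _ (f t)%:E); first by rewrite lee_fin.
by apply: ereal_sup_ubound; exists t => //; exact: MV.
Qed.

Theorem proposition6p6 (R : realType) (g : R -> R)
  (g_ge0 : forall t : R, 0 <= t -> 0 <= g t)
  (g_infty : g t @[t --> +oo] --> +oo)
  (g_sublinear : g t / t @[t --> +oo] --> (0 : R)) :
  exists phi : R -> R[i] -> R[i],
    [/\ parabolic phi, zero_hyperbolic_step phi &
      limf_esup (fun t : R => (total_speed phi t / g t)%:E) +oo = +oo%E].
Proof.
(* Beyond T n, the quotient g t / t is at most 1 / (n + 1) ^ 2. *)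
have [T HT] : exists T : nat -> R, forall n, n%:R <= T n /\
    forall t, T n <= t -> 0 < g t /\ g t / t <= n.+1%:R ^- 2.
  suff /choice[T HT] : forall n, exists M : R, n%:R <= M /\
      forall t, M <= t -> 0 < g t /\ g t / t <= n.+1%:R ^- 2 by exists T.
  move=> n; have e0 : 0 < n.+1%:R ^- 2 :> R by rewrite invr_gt0 exprn_gt0.
  have : \forall t \near +oo, 0 < g t /\ g t / t <= n.+1%:R ^- 2.
    near=> t; split.
      by near: t; move/cvgryPgt : g_infty; apply.
    have : `|0 - g t / t| <= n.+1%:R ^- 2.
      by near: t; move/cvgrPdist_le : g_sublinear; apply.
    by rewrite sub0r normrN; apply: le_trans; rewrite ler_norm.
  move=> [M [_ MH]]; exists (Num.max n%:R (M + 1)); split; first by rewrite le_max lexx.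
  by move=> t; rewrite ge_max => /andP[_ Mt]; apply: MH; apply: lt_le_trans Mt; rewrite ltrDl.
pose c := sparse_coef T; pose phi := disk_flow c.
have c_gt0 := sparse_coef_gt0 T; have c_le1 := sparse_coef_le1 T.
have c_0 := sparse_coef_0 T; have c_cvg := sparse_coef_cvg (T := T).
have model : holomorphic_model phi setT (disk_koenigs c) by exact: disk_flow_model.
exists phi; split.
- split; first exact: disk_flow_semigroup.
  exists setT, (disk_koenigs c); split=> // -[r r0 e].
  have : [set: R[i]] (- 1) by [].
  by rewrite e /= oppr_gt0 ltr10.
- by exists (disk_koenigs c).
apply: limf_esup_pinfty => A M.
(* The speed is measured at the time t of the orbit at which the point of the
   half-plane is expR s, for the index n + 1, where n exceeds 4 |A| and |M|. *)
pose n := Num.bound (Num.max (4 * `|A|) `|M|).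
have nAM : Num.max (4 * `|A|) `|M| < n%:R.
  by apply: archi_boundP; rewrite le_max normr_ge0 orbT.
move: nAM; rewrite gt_max => /andP[nA nM].
have [Tn HTn] := HT n.+1.
pose s := sparse_log T n.+1.
pose t := complex.Re (koenigs c (expR s)%:C%C) - complex.Re (koenigs c 1).
have /andP[h1_ge0 h1_le] := koenigs_sparse_1 T.
have hX_ge := koenigs_sparse_ge T n.+1; have hX_le := koenigs_sparse_le T n.+1.
have s_ge := sparse_log_ge T n.
have Tt : T n.+1 <= t.
  rewrite /t; have := ler_norm (T n.+1); rewrite -/s -/c in s_ge hX_ge h1_le *; lra.
have n1 : (n%:R : R) < n.+1%:R by rewrite ltr_nat.
have t0 : 0 < t by apply: lt_le_trans Tt; apply: lt_le_trans Tn; rewrite ltr0n.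
exists t.
  apply: lt_le_trans Tt; apply: lt_le_trans Tn; apply: le_lt_trans (ler_norm M) _.
  exact: lt_trans n1.
have [gt gtt] := HTn t Tt.
rewrite total_speed_disk_flow//; last 2 first.
- by rewrite -expR0 ler_expR sparse_log_ge0.
- exact: ltW.
rewrite expRK -/s ler_pdivlMr//.
have m0 : 0 < n.+2%:R :> R by rewrite ltr0n.
have g_le : g t * n.+2%:R ^+ 2 <= t.
  by move: gtt; rewrite ler_pdivrMr// mulrC ler_pdivlMr// exprn_gt0.
have t_le : t <= 2 * n.+2%:R * s.
  have s10 : 10 <= s by apply: le_trans s_ge; rewrite lerDr.
  have m2 : 2 <= n.+2%:R :> R by rewrite ler_nat.
  rewrite /t; apply: (@le_trans _ _ (n.+2%:R * (s + 1) + 2)).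
    by rewrite -/s -/c in hX_le *; lra.
  nra.
have Am : 4 * A <= n.+2%:R.
  apply: le_trans (ltW (lt_trans nA (lt_trans n1 _))); last by rewrite ltr_nat.
  by rewrite ler_wpM2l// ler_norm.
have gms : g t * n.+2%:R <= 2 * s.
  rewrite -(ler_pM2r m0) -mulrA -expr2; apply: le_trans g_le _.
  by apply: le_trans t_le _; rewrite mulrAC.
have Ag : 4 * A * g t <= n.+2%:R * g t by rewrite ler_pM2r.
lra.
Unshelve. all: by end_near. Qed.
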